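(* Let $v,w',w\in S_n$ with $v\le w'$ and $w'\lessdot w$. Then the complexity of the Kazhdan-Lusztig variety $\mathcal N_{v,w}$ is either the same as, or one more than, the complexity of $\mathcal N_{v,w'}$.
   Context: $\le$ is the Bruhat order on $S_n$, $\ell$ is the Coxeter length, and $w'\lessdot w$ means $w'<w$ and $\ell(w)=\ell(w')+1$. Let $B$ (resp. $B_-$) be the upper (resp. lower) triangular Borel subgroup of $G=GL_n(\mathbb C)$ and $T$ the diagonal torus. For $v\le w$ the Kazhdan-Lusztig variety is $\mathcal N_{v,w}=\overline{BwB/B}\cap B_-vB/B\subset G/B$; its dimension is $\ell(w)-\ell(v)$. The usual torus action on $\mathcal N_{v,w}$ is the action of $T$ by left multiplication. With $D^\circ(v)=\{(i,j): v(j)<i,\ v^{-1}(i)>j\}$ and $t_{a,b}$ the transposition of $a,b$, its weight cone is $\sigma_{v,w}=\mathrm{Cone}(e_{v(j)}-e_i : (i,j)\in D^\circ(v),\ t_{v(j),i}\,v\le w)\subset\mathbb R^n$. The complexity of $\mathcal N_{v,w}$ is $\dim\mathcal N_{v,w}-\dim\sigma_{v,w}$. *)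

(* Defs.v *)
From mathcomp Require Import all_boot all_order all_algebra all_fingroup.
From mathcomp Require Import boolp classical_sets reals ereal.
From mathcomp Require Import complex.
(* Not imported: the notations of mpoly clash with those of the other files. *)
From mathcomp Require mpoly.

Set Implicit Arguments.
Unset Strict Implicit.
Unset Printing Implicit Defensive.

Import Order.TTheory GRing.Theory Num.Theory.

Local Open Scope classical_set_scope.
Local Open Scope ring_scope.

(* In 'S_n the library product is (s * t) i = t (s i).  Hence the product of
   functions "t_{a,b} v" (apply v, then swap the values a and b) is
   v * tperm a b. *)

Definition simple_reflection n (s : 'S_n) : bool :=
  [exists i : 'I_n, [exists j : 'I_n, (j == i.+1 :> nat) && (s == tperm i j)]].

Definition has_word n (w : 'S_n) (k : nat) : bool :=
  [exists s : k.-tuple 'S_n,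
    all (@simple_reflection n) s && (w == (\prod_(t <- s) t)%g)].

Lemma has_wordM n (u w : 'S_n) k l :
  has_word u k -> has_word w l -> has_word (u * w)%g (k + l).
Proof.
move=> /existsP[s /andP[sS /eqP->]] /existsP[t /andP[tS /eqP->]].
apply/existsP; exists [tuple of s ++ t].
by rewrite all_cat sS tS /= big_cat.
Qed.

Lemma tperm_has_word n (i j : 'I_n) : exists k, has_word (tperm i j) k.
Proof.
suff main d : forall i j : 'I_n, j = (i + d)%N :> nat ->
    exists k, has_word (tperm i j) k.
  have [le_ij|lt_ji] := leqP i j; first by apply: (main (j - i)%N); rewrite subnKC.
  by rewrite tpermC; apply: (main (i - j)%N); rewrite subnKC // ltnW.
elim: d => [|d IHd] {}i {}j jE.
  have -> : j = i by apply: val_inj; rewrite /= jE addn0.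
  exists 0; apply/existsP; exists [tuple].
  by rewrite big_nil tperm1 /=.
have hn : (i + d < n)%N by apply: leq_trans (ltn_ord j); rewrite jE addnS.
pose h := Ordinal hn.
have [k hk] := IHd i h erefl.
have hhj : has_word (tperm h j) 1.
  apply/existsP; exists [tuple tperm h j]; rewrite big_seq1 eqxx /= !andbT.
  by apply/existsP; exists h; apply/existsP; exists j; rewrite jE addnS !eqxx.
have [d0|d_gt0] := posnP d.
  exists 1; suff -> : i = h by [].
  by apply: val_inj; rewrite /= d0 addn0.
exists (1 + (k + 1))%N.
have -> : tperm i j = (tperm h j * (tperm i h * tperm h j))%g.
  have := tpermJ i h (tperm h j); rewrite tpermL tpermD.
  - by rewrite /conjg tpermV => ->.
  - by rewrite -val_eqE /= -[X in _ == X]addn0 eqn_add2l -lt0n.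
  - by rewrite -val_eqE /= jE -[X in _ == X]addn0 eqn_add2l.
by do 2 apply: has_wordM => //.
Qed.

Lemma has_word_ex n (w : 'S_n) : exists k, has_word w k.
Proof.
have [ts -> _] := prod_tpermP w.
elim: ts => [|t ts [k hk]].
  by exists 0; apply/existsP; exists [tuple]; rewrite !big_nil /=.
have [l hl] := tperm_has_word t.1 t.2.
by exists (l + k)%N; rewrite big_cons; apply: has_wordM.
Qed.

Definition coxeter_length n (w : 'S_n) : nat := ex_minn (has_word_ex w).

Definition bruhat_step n : rel 'S_n := fun u w =>
  [exists a : 'I_n, [exists b : 'I_n, w == (u * tperm a b)%g]]
  && (coxeter_length u < coxeter_length w)%N.

Definition bruhat_le n : rel 'S_n := connect (@bruhat_step n).

Definition bruhat_cover n : rel 'S_n := fun u w =>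
  [&& bruhat_le u w, u != w & coxeter_length w == (coxeter_length u).+1].

Section Krull.
(* cl is the family of closed sets of a topology on X. *)
Variables (X : Type) (cl : set (set X)).

(* Irreducibility of Z for the induced topology; it does not depend on the
   subspace in which Z is considered. *)
Definition irreducible_set (Z : set X) : Prop :=
  Z !=set0 /\
  forall F1 F2, cl F1 -> cl F2 -> Z `<=` F1 `|` F2 -> Z `<=` F1 \/ Z `<=` F2.

Definition closed_in (Y Z : set X) : Prop := exists2 F, cl F & Z = Y `&` F.

Definition has_chain (Y : set X) (d : nat) : Prop :=
  exists Z : nat -> set X,
    (forall i, (i <= d)%N -> closed_in Y (Z i) /\ irreducible_set (Z i)) /\
    (forall i, (i < d)%N -> Z i `<` Z i.+1).

Definition krull_dim (R : realType) (Y : set X) : \bar R :=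
  ereal_sup [set (d%:R)%:E | d in has_chain Y].

End Krull.

Section Flag.
Variables (C : fieldType) (n : nat).
Local Notation M := 'M[C]_n.

Definition GL : set M := [set g | g \in unitmx].

(* is_trig_mx means lower triangular. *)
Definition borel : set M := [set b | b \in unitmx /\ is_trig_mx b^T].
Definition borel_opp : set M := [set b | b \in unitmx /\ is_trig_mx b].

(* Points of G/B are the left cosets gB, viewed as sets of matrices. *)
Definition flag (g : M) : set M := [set g *m b | b in borel].
Definition flag_variety : set (set M) := [set flag g | g in GL].

(* The Zariski topology of GL_n: dividing by powers of det, zero loci of
   regular functions are zero loci of polynomials in the n * n entries. *)
Definition zariski_closed_GL (Z : set M) : Prop :=
  exists S : set (mpoly.mpoly (n * n) C),
    Z = [set g | GL g /\ forall p, S p -> mpoly.meval (mxvec g 0) p = 0].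

(* G -> G/B is open, so the Zariski topology of G/B is the quotient one. *)
Definition zariski_closed : set (set (set M)) := fun F =>
  F `<=` flag_variety /\ zariski_closed_GL [set g | GL g /\ F (flag g)].

(* The matrix of w sends e_j to e_{w(j)}; perm_mx uses the transpose. *)
Definition pmat (w : 'S_n) : M := (perm_mx w)^T.

Definition schubert_cell (w : 'S_n) : set (set M) :=
  [set flag (b *m pmat w) | b in borel].

Definition schubert_variety (w : 'S_n) : set (set M) :=
  smallest zariski_closed (schubert_cell w).

Definition opposite_cell (v : 'S_n) : set (set M) :=
  [set flag (b *m pmat v) | b in borel_opp].

Definition kazhdan_lusztig (v w : 'S_n) : set (set M) :=
  schubert_variety w `&` opposite_cell v.

End Flag.

Section Complexity.
Variables (R : realType) (n : nat).
Local Notation V := 'rV[R]_n.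

Definition cone (S : seq V) : set V :=
  [set x | exists c : V -> R,
    (forall u, 0 <= c u) /\ x = \sum_(u <- S) c u *: u].

(* Dimension of the linear span of K (its affine hull if 0 is in K). *)
Definition cone_dim (K : set V) : nat :=
  \max_(k < n.+1
      | `[< exists X : k.-tuple V, (forall i, K (tnth X i)) /\ free X >]) k.

Local Notation e a := (delta_mx 0 a : V).

Definition opp_diagram (v : 'S_n) (ij : 'I_n * 'I_n) : bool :=
  (v ij.2 < ij.1)%N && (ij.2 < v^-1%g ij.1)%N.

Definition weight_cone (v w : 'S_n) : set V :=
  cone [seq e (v ij.2) - e ij.1 | ij <- enum {: 'I_n * 'I_n}
         & opp_diagram v ij && bruhat_le (v * tperm (v ij.2) ij.1)%g w].

Definition complexity (v w : 'S_n) : \bar R :=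
  (krull_dim (@zariski_closed (complex R) n) R (kazhdan_lusztig v w)
   - ((cone_dim (weight_cone v w))%:R)%:E)%E.

End Complexity.

(* Main.v *)
Require Import Defs.
From mathcomp Require Import all_boot all_order all_algebra all_fingroup.
From mathcomp Require Import boolp classical_sets reals ereal complex.
From mathcomp Require mpoly.
From mathcomp Require Import zify ring.
From Stdlib Require List.
(* The notations of mpoly clash with those of the other files. *)
Import (canonicals) mpoly.

(* The dimension of [N_{v,w}] is [l(w) - l(v)], so it increases by one from [w'] to
   [w], and it remains to see that the dimension of the weight cone increases by at
   most one.

   Dimension.  [N_{v,w}] is a retract of the intersection of the Schubert variety
   [X_w] with the open cell [v B_- B], hence irreducible, and the [N_{v,x_i}] along a
   saturated Bruhat chain from [v] to [w] give the lower bound.  Conversely, in a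
   chain of length [d] of irreducible closed subsets, functions that vanish on one
   member but not on the next are algebraically independent; together with the
   [l(v)] coordinates of the fibres of the retraction they give [d + l(v)]
   independent rational functions on an affine space of dimension [l(w)].

   Cone.  Call two permutations equivalent if their values agree up to a fixed
   equivalence relation [e] on [{1..n}].  Completing paths of length two in the
   Bruhat graph to diamonds shows that if [e] relates [a] and [b] whenever
   [v < t_{a,b} v <= w'], then [[v,w']] is contained in one class.  If moreover [w']
   and [w = t_{c,d} w'] are equivalent, an induction on [l(w)] with the lifting
   property shows that the whole of [[v,w]] is in that class.  Applied to the
   relation [e_a - e_b \in U], with [U] spanned by the cone of [(v,w')] and
   [e_c - e_d], this says that [U] contains the cone of [(v,w)]. *)

Set Implicit Arguments.
Unset Strict Implicit.
Unset Printing Implicit Defensive.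

Import Order.TTheory GRing.Theory Num.Theory.

(** * Inversions and the Bruhat order *)

(** Passing from [w'] to [w] may bring in many new weights at once, and all of them must lie in the
    span enlarged by the single vector [e_c - e_d]. Since membership of [e_a - e_b] in a subspace is
    an equivalence relation on indices, this linear statement becomes one about cosets of a Young
    subgroup, where induction on length is possible. The relation has to vary in that induction,
    because inversion of permutations conjugates it. The upper bound for chains is a linear count:
    polynomials of degree at most [D] in each of [d] variables have [(D + 1)^d] coefficients, while
    vanishing on an affine space of dimension [l] costs a number of conditions of order [D^l].
    Characteristic zero provides the integer points at which vanishing is tested. *)

Section Inversions.
Variable n : nat.
Implicit Types (u v w x y : 'S_n) (a b c d : 'I_n).

(** Recorded by values: right multiplication by a transposition exchanges values, and the same pairs
    later index the free entries of the Schubert cell ([up]). *)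
Definition inversions w : {set 'I_n * 'I_n} :=
  [set p : 'I_n * 'I_n | (p.1 < p.2)%N && (w^-1%g p.2 < w^-1%g p.1)%N].

Definition ninv w := #|inversions w|.

Definition between w a b c : bool :=
  (a < c < b)%N && (w^-1%g a < w^-1%g c < w^-1%g b)%N.

(** Isolates the rows and columns [a] and [b], the only ones that a transposition of [a] and [b]
    affects in the double sum counting inversions. *)
Lemma sum2D2 (f : 'I_n -> 'I_n -> nat) a b : a != b ->
  (\sum_x \sum_y f x y =
  \sum_(x | (x != a) && (x != b)) \sum_(y | (y != a) && (y != b)) f x y
   + \sum_(c | (c != a) && (c != b)) ((f a c + f c a) + (f b c + f c b))
   + (f a b + f b a + f a a + f b b))%N.
Proof.
move=> ab.
have split1 (g : 'I_n -> nat) :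
    (\sum_x g x = g a + g b + \sum_(x | (x != a) && (x != b)) g x)%N.
  by rewrite (bigD1 a) //= (bigD1 b) 1?eq_sym //= addnA.
rewrite split1 !split1.
under [X in (_ + X)%N = _]eq_bigr => x _ do rewrite split1.
rewrite !big_split /=; lia.
Qed.

Lemma ninvE w : ninv w = (\sum_(x : 'I_n) \sum_(y : 'I_n) ((x < y) && (w^-1%g y < w^-1%g x)))%N.
Proof.
rewrite /ninv -sum1dep_card pair_big /= big_mkcond /=.
by apply: eq_bigr => -[x y] _ /=; case: ifP.
Qed.

Lemma tpermVE w a b c : (w * tperm a b)^-1%g c = w^-1%g (tperm a b c).
Proof. by rewrite invMg tpermV permM. Qed.

(** The pair [(a, b)] becomes one new inversion. A third value [c] gains two, one with [a] and one
    with [b], when it lies between them both in value and in position; otherwise its total is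
    unchanged. *)
Lemma ninv_tperm w a b : (a < b)%N -> (w^-1%g a < w^-1%g b)%N ->
  ninv (w * tperm a b)%g =
    (ninv w + (#|[pred c | between w a b c]|).*2.+1)%N.
Proof.
move=> ab pab; have neq_ab : a != b by rewrite -val_eqE /= neq_ltn ab.
have -> : #|[pred c | between w a b c]| =
    (\sum_(c : 'I_n | (c != a) && (c != b)) between w a b c)%N.
  rewrite -sum1_card big_mkcond [RHS]big_mkcond; apply: eq_bigr => c _.
  rewrite inE /between; have [->|] := eqVneq c a; first by rewrite ltnn.
  by have [->|] := eqVneq c b; [rewrite ltnn andbF | case: ifP].
rewrite !ninvE !(sum2D2 _ neq_ab) -mul2n big_distrr /=.
rewrite !tpermVE !tpermL !tpermR.
have -> : (\sum_(x : 'I_n | (x != a) && (x != b)) \sum_(y : 'I_n | (y != a) && (y != b))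
    ((x < y) && ((w * tperm a b)^-1%g y < (w * tperm a b)^-1%g x)))%N =
    (\sum_(x : 'I_n | (x != a) && (x != b)) \sum_(y : 'I_n | (y != a) && (y != b))
    ((x < y) && (w^-1%g y < w^-1%g x)))%N.
  apply: eq_bigr => x /andP[xa xb]; apply: eq_bigr => y /andP[ya yb].
  by rewrite !tpermVE !tpermD // eq_sym.
suff -> : (\sum_(c : 'I_n | (c != a) && (c != b))
     ((a < c) && ((w * tperm a b)^-1%g c < w^-1%g b) +
      (c < a) && (w^-1%g b < (w * tperm a b)^-1%g c) +
      ((b < c) && ((w * tperm a b)^-1%g c < w^-1%g a) +
       (c < b) && (w^-1%g a < (w * tperm a b)^-1%g c))))%N =
     (\sum_(c : 'I_n | (c != a) && (c != b))
     ((a < c) && (w^-1%g c < w^-1%g a) +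
      (c < a) && (w^-1%g a < w^-1%g c) +
      ((b < c) && (w^-1%g c < w^-1%g b) +
       (c < b) && (w^-1%g b < w^-1%g c))) +
     \sum_(c : 'I_n | (c != a) && (c != b)) 2 * between w a b c)%N.
  have ba : (b < a)%N = false by rewrite ltnNge (ltnW ab).
  have pba : (w^-1%g b < w^-1%g a)%N = false by rewrite ltnNge (ltnW pab).
  by rewrite !ltnn !andbF ab pab ba pba /= !addn0 addn1 addnS addnA.
rewrite -big_split /=; apply: eq_bigr => c /andP[ca cb].
rewrite !tpermVE !tpermD 1?eq_sym // /between.
have pca : w^-1%g c != w^-1%g a :> nat by rewrite (inj_eq val_inj) (inj_eq perm_inj).
have pcb : w^-1%g c != w^-1%g b :> nat by rewrite (inj_eq val_inj) (inj_eq perm_inj).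
move: ca cb; rewrite -!val_eqE /=.
move: (nat_of_ord (w^-1%g c)) (nat_of_ord (w^-1%g a)) (nat_of_ord (w^-1%g b)) pab pca pcb => k i j.
lia.
Qed.

End Inversions.

(** * Coxeter length as the number of inversions, and Bruhat covers *)

Section Length.
Variable n : nat.
Implicit Types (u v w x y z : 'S_n) (a b c i j : 'I_n).

Lemma tperm_mulK w a b : (w * tperm a b * tperm a b)%g = w.
Proof. by rewrite -mulgA tperm2 mulg1. Qed.

Lemma ltn_perm_neq w a b : a != b -> (w a < w b)%N = ~~ (w b < w a)%N.
Proof.
move=> ab; have : w a != w b :> nat by rewrite (inj_eq val_inj) (inj_eq perm_inj).
lia.
Qed.

Lemma ninv_tperm_lt w a b : (a < b)%N ->
  (ninv w < ninv (w * tperm a b)%g)%N = (w^-1%g a < w^-1%g b)%N.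
Proof.
move=> ab; have neq_ab : a != b by rewrite -val_eqE /= neq_ltn ab.
have [pab|] := boolP (w^-1%g a < w^-1%g b)%N; first by rewrite ninv_tperm //; lia.
rewrite -(ltn_perm_neq w^-1%g) 1?eq_sym // => pba.
have := @ninv_tperm _ (w * tperm a b)%g a b ab.
rewrite !tpermVE tpermL tpermR tperm_mulK => /(_ pba); lia.
Qed.

Lemma perm_increasing1 w :
  (forall i j, j = i.+1 :> nat -> (w i < w j)%N) -> w = 1%g.
Proof.
move=> inc.
(* Used from [0] to [i] this gives [i <= w i], and from [i] to [n.-1] it gives [w i <= i]. *)
have incd m i j : j = (i + m)%N :> nat -> (w i + m <= w j)%N.
  elim: m j => [|m IHm] j ji.
    have -> : j = i by apply: val_inj; rewrite /= ji addn0.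
    by rewrite addn0.
  have lt_j : (i + m < n)%N by have := ltn_ord j; lia.
  have incj : (w (Ordinal lt_j) < w j)%N by apply: inc; rewrite ji addnS.
  by apply: leq_trans incj; rewrite addnS ltnS; apply: IHm.
apply/permP => i; rewrite perm1; apply: val_inj => /=.
have n_gt0 : (0 < n)%N by apply: leq_ltn_trans (ltn_ord i).
have lt_n1 : (n.-1 < n)%N by rewrite prednK.
have := @incd i (Ordinal n_gt0) i erefl.
have := @incd (n.-1 - i)%N i (Ordinal lt_n1).
have := ltn_ord i; have := ltn_ord (w (Ordinal lt_n1)); rewrite /=; lia.
Qed.

Lemma ex_descent w : w != 1%g ->
  exists i j : 'I_n, j = i.+1 :> nat /\ (w j < w i)%N.
Proof.
move=> w1.
have [/existsP[i /existsP[j /andP[/eqP ij lt_w]]]|/existsPn noij] :=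
  boolP [exists i : 'I_n, [exists j : 'I_n, (j == i.+1 :> nat) && (w j < w i)%N]].
  by exists i, j.
case/eqP: w1; apply: perm_increasing1 => i j ij.
rewrite ltn_perm_neq ?(eq_sym i) -?val_eqE /= ?ij; last by lia.
by have /existsPn/(_ j) := noij i; rewrite ij eqxx.
Qed.

Lemma no_between w a b c : b = a.+1 :> nat -> between w a b c = false.
Proof. by rewrite /between => ->; lia. Qed.

Lemma ninv_simple w a b : b = a.+1 :> nat -> (w^-1%g a < w^-1%g b)%N ->
  ninv (w * tperm a b)%g = (ninv w).+1.
Proof.
move=> ab pab; rewrite ninv_tperm ?ab // (_ : #|_| = 0%N) ?addn1 //.
by apply: eq_card0 => c; rewrite !inE no_between.
Qed.

Lemma ninv1 : ninv (1 : 'S_n)%g = 0%N.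
Proof. by apply: eq_card0 => -[x y]; rewrite !inE invg1 !perm1 /=; lia. Qed.

Lemma has_word_ninv_le w k : has_word w k -> (ninv w <= k)%N.
Proof.
suff main (s : seq 'S_n) : all (@simple_reflection n) s ->
    (ninv (\prod_(t <- s) t)%g <= size s)%N.
  by case/existsP=> s /andP[sS /eqP->]; have := main _ sS; rewrite size_tuple.
elim/last_ind: s => [_|s t IHs]; first by rewrite big_nil ninv1.
rewrite all_rcons => /andP[/existsP[a /existsP[b /andP[/eqP ab /eqP->]]] sS].
rewrite -cats1 big_cat /= big_seq1 size_cat /= addn1.
apply: leq_trans (_ : _ <= (ninv (\prod_(t0 <- s) t0)%g).+1)%N _; last exact: IHs.
set u := (\prod_(t0 <- s) t0)%g; rewrite -/u.
have [pab|] := boolP (u^-1%g a < u^-1%g b)%N; first by rewrite ninv_simple.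
by rewrite -(ninv_tperm_lt u) ?ab // -leqNgt => /leqW.
Qed.

(** Sorting: each exchange at a descent of [w^-1] removes exactly one inversion. *)
Lemma has_word_ninv w : has_word w (ninv w).
Proof.
move: {2}(ninv w) (erefl (ninv w)) => m; elim: m w => [|m IHm] w wm.
  have [w1|/ex_descent[i [j [ij lt_ji]]]] := eqVneq w^-1%g 1%g.
    rewrite -[w]invgK w1 invg1 ninv1.
    by apply/existsP; exists [tuple]; rewrite big_nil /=.
  have := @ninv_simple (w * tperm i j)%g i j ij.
  by rewrite !tpermVE tpermL tpermR tperm_mulK lt_ji wm => /(_ isT).
have [w1|/ex_descent[i [j [ij lt_ji]]]] := eqVneq w^-1%g 1%g.
  by move: wm; rewrite -[w]invgK w1 invg1 ninv1.
have := @ninv_simple (w * tperm i j)%g i j ij.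
rewrite !tpermVE tpermL tpermR tperm_mulK lt_ji wm => /(_ isT) [wij].
rewrite -addn1 -[X in has_word X](tperm_mulK w i j).
apply: has_wordM; first by rewrite wij; apply: IHm.
apply/existsP; exists [tuple tperm i j]; rewrite big_seq1 eqxx /= !andbT.
by apply/existsP; exists i; apply/existsP; exists j; rewrite ij !eqxx.
Qed.

Lemma coxeter_lengthE w : coxeter_length w = ninv w.
Proof.
rewrite /coxeter_length; case: ex_minnP => k hk /(_ _ (has_word_ninv w)) le_k.
by apply/eqP; rewrite eqn_leq le_k /=; apply: has_word_ninv_le.
Qed.

Lemma bruhat_stepP u w :
  reflect (exists a b, [/\ (a < b)%N, (u^-1%g a < u^-1%g b)%N & w = (u * tperm a b)%g])
    (bruhat_step u w).
Proof.
rewrite /bruhat_step !coxeter_lengthE; apply: (iffP andP).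
  case=> /existsP[a /existsP[b /eqP->]] lt_uw.
  have [ab|ba|/val_inj ab] := ltngtP a b.
  - by exists a, b; split=> //; rewrite -ninv_tperm_lt.
  - by exists b, a; rewrite tpermC; split=> //; rewrite -ninv_tperm_lt // tpermC.
  - by move: lt_uw; rewrite ab tperm1 mulg1 ltnn.
case=> a [b [ab pab ->]]; split; last by rewrite ninv_tperm_lt.
by apply/existsP; exists a; apply/existsP; exists b.
Qed.

Lemma bruhat_step_tperm u a b : (a < b)%N -> (u^-1%g a < u^-1%g b)%N ->
  bruhat_step u (u * tperm a b)%g.
Proof. by move=> ab pab; apply/bruhat_stepP; exists a, b. Qed.

Lemma bruhat_step_lt u w : bruhat_step u w -> (ninv u < ninv w)%N.
Proof. by rewrite -!coxeter_lengthE => /andP[]. Qed.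

Lemma bruhat_le_trans v u w : bruhat_le u v -> bruhat_le v w -> bruhat_le u w.
Proof. exact: connect_trans. Qed.

Lemma bruhat_le_refl w : bruhat_le w w.
Proof. exact: connect0. Qed.

Lemma bruhat_step_le u w : bruhat_step u w -> bruhat_le u w.
Proof. exact: connect1. Qed.

Lemma bruhat_le_ind (P : 'S_n -> Prop) u :
  P u -> (forall y w, bruhat_le u y -> P y -> bruhat_step y w -> P w) ->
  forall w, bruhat_le u w -> P w.
Proof.
move=> Pu IH w /connectP[p up ->]; elim/last_ind: p up => [//|p z IHp].
rewrite rcons_path last_rcons => /andP[up pz].
by apply: IH pz; [apply/connectP; exists p | apply: IHp].
Qed.

Lemma bruhat_le_inv u w : bruhat_le u w -> (u = w) \/ (ninv u < ninv w)%N.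
Proof.
move: w; apply: bruhat_le_ind => [|y w _ IH /bruhat_step_lt yw].
  by left.
by right; case: IH => [->//|uy]; apply: ltn_trans yw.
Qed.

Lemma bruhat_le_ninv u w : bruhat_le u w -> (ninv u <= ninv w)%N.
Proof. by case/bruhat_le_inv=> [->//|/ltnW]. Qed.

Lemma bruhat_le_last u w : bruhat_le u w ->
  u = w \/ exists2 y, bruhat_le u y & bruhat_step y w.
Proof.
by move: w; apply: bruhat_le_ind => [|y w uy _ yw];
  [left | right; exists y].
Qed.

(** If the last step, by [t_{a,b}], is not a cover, some [c] lies between [a] and [b], and the step
    splits into three rising ones, by [t_{a,c}], [t_{a,b}] and [t_{c,b}]. The last of these starts
    closer to [w]. *)
Lemma bruhat_le_chain u w : bruhat_le u w -> u <> w ->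
  exists y, [/\ bruhat_le u y, bruhat_step y w & ninv w = (ninv y).+1].
Proof.
move=> /bruhat_le_last[//|[y]] uy yw _.
move: {2}(ninv w - ninv y)%N (leqnn (ninv w - ninv y)) => m.
elim: m y uy yw => [|m IHm] y uy yw le_m.
  by have := bruhat_step_lt yw; lia.
have [eq_yw|neq_yw] := eqVneq (ninv w) (ninv y).+1; first by exists y.
have [a [b [ab pab def_w]]] := bruhat_stepP _ _ yw.
have [c btw] : exists c, between y a b c.
  apply/existsP; apply: contraR neq_yw => /existsPn no_c.
  rewrite def_w ninv_tperm // (_ : #|_| = 0%N) ?addn1 //.
  by apply: eq_card0 => c; rewrite !inE; apply/negbTE.
case/andP: btw => /andP[ac cb] /andP[pac pcb].
have D (i j : 'I_n) : (i < j)%N -> (i != j) * (j != i).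
  by move=> ij; rewrite eq_sym -val_eqE /= neq_ltn ij orbT.
pose y1 := (y * tperm a c)%g; pose y2 := (y1 * tperm a b)%g.
have y1a : y1^-1%g a = y^-1%g c by rewrite tpermVE tpermL.
have y1c : y1^-1%g c = y^-1%g a by rewrite tpermVE tpermR.
have y1b : y1^-1%g b = y^-1%g b by rewrite tpermVE tpermD // ?(D _ _ ab) ?(D _ _ cb).
have yy1 : bruhat_step y y1 by apply: bruhat_step_tperm.
have y1y2 : bruhat_step y1 y2 by apply: bruhat_step_tperm; rewrite ?y1a ?y1b.
have y2w : w = (y2 * tperm c b)%g.
  rewrite def_w /y2 /y1 -!mulgA; congr (_ * _)%g.
  apply/permP => i; rewrite !permM.
  have /eqP ab' : a != b by rewrite D.
  have /eqP ac' : a != c by rewrite D.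
  have /eqP cb' : c != b by rewrite D.
  by repeat case: tpermP; congruence.
have y2w_step : bruhat_step y2 w.
  rewrite y2w; apply: bruhat_step_tperm => //.
  have -> : y2^-1%g c = y^-1%g a by rewrite tpermVE tpermD ?(D _ _ ac) ?(D _ _ cb).
  by have -> : y2^-1%g b = y^-1%g c by rewrite tpermVE tpermR.
apply: (IHm y2) => //.
  by apply: bruhat_le_trans uy _; apply: (@bruhat_le_trans y1); apply: bruhat_step_le.
by have := bruhat_step_lt yy1; have := bruhat_step_lt y1y2; lia.
Qed.

Lemma bruhat_coverP u w : bruhat_cover u w ->
  bruhat_step u w /\ ninv w = (ninv u).+1.
Proof.
rewrite /bruhat_cover !coxeter_lengthE => /and3P[uw /eqP neq_uw /eqP len].
split=> //; have [//|[y uy yw]] := bruhat_le_last uw.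
have := bruhat_step_lt yw; have [->//|] := bruhat_le_inv uy; lia.
Qed.

Lemma ninvV w : ninv w^-1%g = ninv w.
Proof.
pose f (p : 'I_n * 'I_n) := (w p.2, w p.1).
rewrite /ninv -(card_in_imset (f := f)); last first.
  by move=> [p q] [p' q'] _ _ [/perm_inj-> /perm_inj->].
apply: eq_card => -[p q]; apply/imsetP/idP.
  by case=> -[p' q']; rewrite !inE invgK /= => /andP[pq qp] [-> ->]; rewrite !permK qp pq.
rewrite inE /= => /andP[pq qp]; exists (w^-1%g q, w^-1%g p).
  by rewrite !inE invgK /= !permKV qp pq.
by rewrite /f /= !permKV.
Qed.

Lemma bruhat_stepV u w : bruhat_step u w -> bruhat_step u^-1%g w^-1%g.
Proof.
case/bruhat_stepP=> a [b [ab pab ->]]; apply/bruhat_stepP.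
exists (u^-1%g a), (u^-1%g b); rewrite !invgK !permKV; split=> //.
rewrite invMg tpermV -tpermJ /conjg invgK !mulgA mulVg mul1g.
by [].
Qed.

Lemma bruhat_leV u w : bruhat_le u w -> bruhat_le u^-1%g w^-1%g.
Proof.
move: w; apply: bruhat_le_ind => [|y w _ IH /bruhat_stepV yw].
  exact: bruhat_le_refl.
by apply: bruhat_le_trans IH _; apply: bruhat_step_le.
Qed.

End Length.

(** * Lifting, diamonds and cosets of Young subgroups *)

Section Lifting.
Variable n : nat.
Implicit Types (u v w x y z : 'S_n) (a b c i j : 'I_n).

(* [tperm i j * x] exchanges the positions [i] and [j], [x * tperm a b] the values
   [a] and [b]. *)
Lemma tperm_mul x i j : (tperm i j * x = x * tperm (x i) (x j))%g.
Proof. by rewrite -tpermJ /conjg !mulgA mulgV mul1g. Qed.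

Lemma simple_step_up i j x : j = i.+1 :> nat -> (x i < x j)%N ->
  bruhat_step x (tperm i j * x)%g /\ ninv (tperm i j * x)%g = (ninv x).+1.
Proof.
move=> ij lt_x; rewrite tperm_mul; split.
  by apply: bruhat_step_tperm; rewrite // !permK ij.
rewrite ninv_tperm ?permK ?ij // (_ : #|_| = 0%N) ?addn1 //.
by apply: eq_card0 => c; rewrite !inE /between !permK ij; lia.
Qed.

(** Exchanging adjacent positions keeps the relative order of every other pair of positions, so the
    step survives unless it exchanges these two positions itself. *)
Lemma simple_step i j u w : j = i.+1 :> nat -> bruhat_step u w ->
  w = (tperm i j * u)%g \/ bruhat_step (tperm i j * u)%g (tperm i j * w)%g.
Proof.
move=> ij /bruhat_stepP[a [b [ab pab ->]]].
have [/andP[/eqP pa /eqP pb]|neq] := boolP ((u^-1%g a == i) && (u^-1%g b == j)).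
  by left; rewrite tperm_mul -pa -pb !permKV.
right; rewrite mulgA; apply: bruhat_step_tperm => //.
rewrite !invMg !tpermV !permM.
move: (u^-1%g a) (u^-1%g b) pab neq => p q pq; rewrite -!val_eqE /= => neq.
have D (k l : 'I_n) : k <> l -> nat_of_ord k <> l by move=> kl /val_inj.
by case: tpermP => [pE|pE|/D pi /D pj]; case: tpermP => [qE|qE|/D qi /D qj]; subst; lia.
Qed.

(** The smaller and the larger of [x] and [s x]: with them the lifting property becomes monotonicity
    of two maps, without cases on descents. *)
Definition lower i j x : 'S_n := if (x i < x j)%N then x else (tperm i j * x)%g.
Definition upper i j x : 'S_n := if (x i < x j)%N then (tperm i j * x)%g else x.

Lemma lower_upper i j x : j = i.+1 :> nat -> bruhat_le (lower i j x) (upper i j x).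
Proof.
move=> ij; rewrite /lower /upper; case: ifP => [lt_x|ge_x].
  by apply: bruhat_step_le; case: (simple_step_up ij lt_x).
have neq_ij : i != j by rewrite -val_eqE /= ij; lia.
have lt_sx : ((tperm i j * x)%g i < (tperm i j * x)%g j)%N.
  by rewrite !permM tpermL tpermR ltn_perm_neq 1?eq_sym // ge_x.
have [] := simple_step_up ij lt_sx.
by rewrite mulgA tperm2 mul1g => /bruhat_step_le.
Qed.

Lemma bruhat_lower_upper i j x y : j = i.+1 :> nat ->
  y = x \/ y = (tperm i j * x)%g ->
  bruhat_le (lower i j x) y /\ bruhat_le y (upper i j x).
Proof.
move=> ij; have := lower_upper x ij; rewrite /lower /upper.
by case: ifP => _ le_x [->|->]; split => //; apply: bruhat_le_refl.
Qed.

(** For a single step from [y] to [w]: either [w = s y] and both pairs coincide, or [s y < s w]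
    holds too, and one of the two steps compares the extremes. *)
Lemma lifting i j u w : j = i.+1 :> nat -> bruhat_le u w ->
  bruhat_le (lower i j u) (lower i j w) /\ bruhat_le (upper i j u) (upper i j w).
Proof.
move=> ij; move: w; apply: bruhat_le_ind => [|y w _ [IHl IHu] yw].
  by split; apply: bruhat_le_refl.
suff [le_l le_u] : bruhat_le (lower i j y) (lower i j w) /\
    bruhat_le (upper i j y) (upper i j w).
  by split; [apply: bruhat_le_trans IHl _ | apply: bruhat_le_trans IHu _].
have [def_w|syw] := simple_step ij yw.
  have lt_y : (y i < y j)%N.
    have := bruhat_step_lt yw; rewrite def_w; case: (ltnP (y i)) => // ge_y.
    have neq_ij : i != j by rewrite -val_eqE /= ij; lia.
    have [|_ ] := @simple_step_up i j (tperm i j * y)%g ij.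
      by rewrite !permM tpermL tpermR (ltn_perm_neq y) 1?eq_sym // -leqNgt.
    rewrite mulgA tperm2 mul1g; lia.
  have w_ij : (w i < w j)%N = false.
    by rewrite def_w !permM tpermL tpermR ltnNge (ltnW lt_y).
  rewrite /lower /upper lt_y w_ij def_w mulgA tperm2 mul1g.
  by split; apply: bruhat_le_refl.
have {}yw := bruhat_step_le yw; have {}syw := bruhat_step_le syw.
have lu z := @bruhat_lower_upper i j z z ij (or_introl erefl).
have slu z := @bruhat_lower_upper i j z _ ij (or_intror erefl).
split.
  rewrite {2}/lower; case: ifP => _.
    by apply: bruhat_le_trans yw; case: (lu y).
  by apply: bruhat_le_trans syw; case: (slu y).
rewrite {1}/upper; case: ifP => _.
  by apply: (bruhat_le_trans syw); case: (slu w).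
by apply: (bruhat_le_trans yw); case: (lu w).
Qed.

End Lifting.

Section Cosets.
Variables (n : nat) (e : rel 'I_n).
Hypothesis e_eq : equivalence_rel e.
Implicit Types (u v w x y z : 'S_n) (a b c i j : 'I_n).

(* [x] and [y] lie in the same right coset of the Young subgroup of the
   permutations preserving the classes of [e]. *)
Definition same_coset x y := forall i, e (x i) (y i).

Lemma equiv_refl a : e a a.
Proof. by have [] := e_eq a a a. Qed.

Lemma equiv_sym a b : e a b = e b a.
Proof.
have aux c i : e c i -> e i c by move=> ci; have [_ /(_ ci) <-] := e_eq c i c; apply: equiv_refl.
by apply/idP/idP; apply: aux.
Qed.

Lemma equiv_trans a b c : e a b -> e b c -> e a c.
Proof. by move=> ab; have [_ /(_ ab) ->] := e_eq a b c. Qed.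

Lemma same_coset_refl x : same_coset x x.
Proof. by move=> i; apply: equiv_refl. Qed.

Lemma same_coset_sym x y : same_coset x y -> same_coset y x.
Proof. by move=> xy i; rewrite equiv_sym. Qed.

Lemma same_coset_trans x y z : same_coset x y -> same_coset y z -> same_coset x z.
Proof. by move=> xy yz i; apply: equiv_trans (xy i) (yz i). Qed.

Lemma same_coset_mull x y z : same_coset x y -> same_coset (z * x)%g (z * y)%g.
Proof. by move=> xy i; rewrite !permM. Qed.

Lemma same_coset_tperm x a b : same_coset x (x * tperm a b)%g <-> e a b.
Proof.
split=> [/(_ (x^-1%g a))|ab i]; first by rewrite permM permKV tpermL.
rewrite permM; case: tpermP => [->|->|_ _] //; last exact: equiv_refl.
by rewrite equiv_sym.
Qed.

End Cosets.

Section Intervals.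
Variables (n : nat) (e : rel 'I_n).
Hypothesis e_eq : equivalence_rel e.
Implicit Types (u v w x y z : 'S_n) (a b c i j p q r : 'I_n).

Local Notation co := (same_coset e).

Lemma bruhat_step_tpermE z p q : p != q ->
  bruhat_step z (z * tperm p q)%g = ((p < q)%N == (z^-1%g p < z^-1%g q)%N).
Proof.
move=> pq; rewrite /bruhat_step !coxeter_lengthE.
have -> /= : [exists a, [exists b, (z * tperm p q == z * tperm a b)%g]].
  by apply/existsP; exists p; apply/existsP; exists q.
have [lt_pq|lt_qp|/val_inj eq_pq] := ltngtP p q.
- by rewrite ninv_tperm_lt.
- by rewrite tpermC ninv_tperm_lt // (ltn_perm_neq z^-1%g) ?eqbF_neg // eq_sym.
- by rewrite eq_pq eqxx in pq.
Qed.

(** A three-cycle on [p, q, r] has three factorizations into two transpositions; besides the given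
    one, at least one of the others also rises twice. Two related pairs among [p, q, r] relate the
    third pair. *)
Lemma diamond_shared z p q r : p != q -> q != r -> p != r ->
  bruhat_step z (z * tperm p q)%g ->
  bruhat_step (z * tperm p q)%g (z * tperm p q * tperm q r)%g ->
  exists a b, [/\ bruhat_step z (z * tperm a b)%g,
    bruhat_step (z * tperm a b)%g (z * tperm p q * tperm q r)%g &
    e p q -> e a b -> e q r].
Proof.
move=> pq qr pr; rewrite !bruhat_step_tpermE // !tpermVE tpermR (@tpermD _ p q r) //.
move=> zpq; have E : (z * tperm p q * tperm q r = z * tperm q r * tperm p r)%g /\
    (z * tperm p q * tperm q r = z * tperm p r * tperm p q)%g.
  move: (pq) (qr) (pr) => /eqP ? /eqP ? /eqP ?.
  by split; rewrite -!mulgA; congr (_ * _)%g; apply/permP => i; rewrite !permM;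
    repeat case: tpermP; congruence.
case: E => E1 E2 yqr.
have [h|h] := boolP (((q < r)%N == (z^-1%g q < z^-1%g r)%N)
   && ((p < r)%N == (z^-1%g p < z^-1%g q)%N)).
  case/andP: h => h1 h2; exists q, r; rewrite E1 !bruhat_step_tpermE //.
  by rewrite !tpermVE tpermR (@tpermD _ q r p) // 1?eq_sym.
exists p, r; rewrite E2 !bruhat_step_tpermE // !tpermVE tpermL (@tpermD _ p r q) //;
  last by rewrite eq_sym.
have D (k l : 'I_n) : k != l -> k != l :> nat /\ z^-1%g k != z^-1%g l :> nat.
  by move=> kl; rewrite !(inj_eq val_inj) (inj_eq perm_inj).
have [] := D _ _ pq; have [] := D _ _ qr; have [] := D _ _ pr.
move=> ? ? ? ? ? ?; split; [lia|lia|].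
by move=> epq epr; apply: equiv_trans epr; rewrite // equiv_sym.
Qed.

(** Disjoint transpositions commute, two that share one value are treated by [diamond_shared], and
    two equal ones would lead back to [z]. *)
Lemma diamond z y x : bruhat_step z y -> bruhat_step y x ->
  exists y', [/\ bruhat_step z y', bruhat_step y' x & co z y -> co z y' -> co z x].
Proof.
move=> zy yx.
have [a [b [ab _ def_y]]] := bruhat_stepP _ _ zy.
have [c [d [cd _ def_x]]] := bruhat_stepP _ _ yx.
have lt_zx := ltn_trans (bruhat_step_lt zy) (bruhat_step_lt yx).
have nab : a != b by rewrite -val_eqE /= neq_ltn ab.
have ncd : c != d by rewrite -val_eqE /= neq_ltn cd.
have shared p q r : y = (z * tperm p q)%g -> x = (y * tperm q r)%g -> p != q ->
    q != r -> exists y', [/\ bruhat_step z y', bruhat_step y' x &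
      co z y -> co z y' -> co z x].
  move=> yE xE pq qr; have [pr|pr] := eqVneq p r.
    by move: lt_zx; rewrite xE yE -pr (tpermC q) tperm_mulK ltnn.
  have := @diamond_shared z p q r pq qr pr; rewrite -yE -xE => /(_ zy yx).
  case=> a' [b' [zy' y'x eab]]; exists (z * tperm a' b')%g; split=> //.
  move=> zy1 /(same_coset_tperm e_eq) eab1; apply: (same_coset_trans e_eq zy1).
  rewrite xE; apply/(same_coset_tperm e_eq); apply: eab => //.
  by apply/(same_coset_tperm e_eq z); rewrite -yE.
have [ac|ac] := eqVneq a c.
  by subst c; apply: (shared b a d); rewrite // 1?tpermC // eq_sym.
have [ad|ad] := eqVneq a d.
  by subst d; apply: (shared b a c); rewrite // 1?tpermC // eq_sym.
have [bc|bc] := eqVneq b c; first by subst c; apply: (shared a b d).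
have [bd|bd] := eqVneq b d.
  by subst d; apply: (shared a b c); rewrite // 1?tpermC // eq_sym.
have comm : (x = z * tperm c d * tperm a b)%g.
  rewrite def_x def_y -!mulgA; congr (_ * _)%g.
  move: (ac) (ad) (bc) (bd) => /eqP ? /eqP ? /eqP ? /eqP ?.
  by apply/permP => i; rewrite !permM; repeat case: tpermP; congruence.
exists (z * tperm c d)%g; split.
- move: yx; rewrite def_x def_y !bruhat_step_tpermE // !tpermVE !tpermD //.
- move: zy; rewrite comm def_y !bruhat_step_tpermE // !tpermVE !tpermD //;
    by rewrite eq_sym.
move=> zy1 /(same_coset_tperm e_eq) ecd; apply: (same_coset_trans e_eq zy1).
by rewrite def_x; apply/(same_coset_tperm e_eq).
Qed.

Lemma same_coset_atoms v w :
  (forall a b, bruhat_step v (v * tperm a b)%g -> bruhat_le (v * tperm a b)%g w -> e a b) ->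
  forall x, bruhat_le v x -> bruhat_le x w -> co x v.
Proof.
move=> atoms x; move: {2}(ninv x).+1 (ltnSn (ninv x)) => m.
elim: m x => // m IHm x; rewrite ltnS => le_m vx xw.
have [<-|[y vy yx]] := bruhat_le_last vx; first exact: same_coset_refl.
have IH u : bruhat_le v u -> bruhat_step u x -> co u v.
  move=> vu ux; apply: IHm => //; first exact: leq_trans (bruhat_step_lt ux) le_m.
  by apply: bruhat_le_trans xw; apply: bruhat_step_le.
have [vy_eq|[z vz zy]] := bruhat_le_last vy.
  have [a [b [_ _ def_x]]] := bruhat_stepP _ _ yx.
  apply: same_coset_sym => //; rewrite def_x -vy_eq.
  by apply/(same_coset_tperm e_eq); apply: atoms; rewrite vy_eq -def_x.
have [y' [zy' y'x coh]] := diamond zy yx.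
have zv : co z v.
  apply: IHm => //.
    by have := bruhat_step_lt zy; have := bruhat_step_lt yx; lia.
  apply: bruhat_le_trans (bruhat_step_le zy) _.
  exact: bruhat_le_trans (bruhat_step_le yx) _.
have yv := IH _ vy yx.
have y'v : co y' v.
  by apply: IH => //; apply: bruhat_le_trans vz _; apply: bruhat_step_le.
apply: (same_coset_trans e_eq _ zv); apply: same_coset_sym => //.
by apply: coh; apply: (same_coset_trans e_eq zv); apply: same_coset_sym.
Qed.

End Intervals.

(** * Extending the coset property from [[v,w']] to [[v,w]] *)

Section Extension.
Variable n : nat.
Implicit Types (u v w x y z : 'S_n) (a b c i j : 'I_n) (e : rel 'I_n).

Definition interval_in_coset e v w :=
  forall x, bruhat_le v x -> bruhat_le x w -> same_coset e x w.

(** Quantified over [e], [v] and [w'] because the induction on [w] changes all of them: it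
    multiplies by [s], and inversion conjugates [e]. *)
Definition coset_extension w := forall e v w', equivalence_rel e -> bruhat_le v w' ->
  bruhat_le w' w -> ninv w = (ninv w').+1 -> same_coset e w' w ->
  (forall x, bruhat_le v x -> bruhat_le x w' -> same_coset e x w) ->
  interval_in_coset e v w.

Lemma lower_id i j x : (x i < x j)%N -> lower i j x = x.
Proof. by rewrite /lower => ->. Qed.
Lemma lower_desc i j x : (x j < x i)%N -> lower i j x = (tperm i j * x)%g.
Proof. by move=> dx; rewrite /lower ltnNge (ltnW dx). Qed.
Lemma upper_id i j x : (x j < x i)%N -> upper i j x = x.
Proof. by move=> dx; rewrite /upper ltnNge (ltnW dx). Qed.
Lemma upper_asc i j x : (x i < x j)%N -> upper i j x = (tperm i j * x)%g.
Proof. by rewrite /upper => ->. Qed.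

Section Core.
Variables (e : rel 'I_n) (v w' w : 'S_n) (i j : 'I_n).
Hypothesis e_eq : equivalence_rel e.
Hypothesis ij : j = i.+1 :> nat.
Local Notation s := (tperm i j).
Local Notation co := (same_coset e).
Hypotheses (vw' : bruhat_le v w') (w'w : bruhat_le w' w) (len : ninv w = (ninv w').+1).
Hypotheses (cow' : co w' w)
  (below : forall x, bruhat_le v x -> bruhat_le x w' -> co x w).
Hypothesis desc : (w j < w i)%N.
Hypothesis good : w' = (s * w)%g -> (v i < v j)%N.
Hypothesis IH : forall w0, (ninv w0 < ninv w)%N -> coset_extension w0.

Let neq_ij : i != j. Proof. by rewrite -val_eqE /= neq_ltn ij leqnn. Qed.

Let ascP x : (x i < x j)%N \/ (x j < x i)%N.
Proof.
by case: (ltngtP (x i) (x j)) => [|| /val_inj/perm_inj eqij];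
  [left | right | case/eqP: neq_ij].
Qed.

Let ninv_s x : (x j < x i)%N -> ninv x = (ninv (s * x)%g).+1.
Proof.
move=> dx; have [|_] := @simple_step_up n i j (s * x)%g ij.
  by rewrite !permM tpermL tpermR.
by rewrite mulgA tperm2 mul1g.
Qed.

Let lenw : ninv w = (ninv (s * w)%g).+1.
Proof. exact: ninv_s. Qed.

Let le_sw x : (x i < x j)%N -> bruhat_le x w -> bruhat_le x (s * w)%g.
Proof.
by move=> ax /(lifting ij)[]; rewrite lower_id // lower_desc.
Qed.

Let s_le_sw x : (x j < x i)%N -> bruhat_le x w -> bruhat_le (s * x)%g (s * w)%g.
Proof. by move=> dx /(lifting ij)[]; rewrite !lower_desc. Qed.

Let desc_w' : w' <> (s * w)%g -> (w' j < w' i)%N.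
Proof.
move=> neq; case: (ascP w') => // aw'.
by case/bruhat_le_inv: (le_sw aw' w'w) => // lt; move: len; rewrite lenw; lia.
Qed.

Let sKK x : (s * (s * x) = x)%g. Proof. by rewrite mulgA tperm2 mul1g. Qed.

Let co_s x y : co (s * x)%g y -> co x (s * y)%g.
Proof. by move=> h; rewrite -[x]sKK; apply: same_coset_mull. Qed.

(** The interval [[v, s w]] is covered by the induction hypothesis for [(v, s w', s w)], or by
    [below] if [w' = s w]. By lifting, every [x] of [[v,w]] has [x] or [s x] in that interval. *)
Lemma extend_ascent : (v i < v j)%N -> interval_in_coset e v w.
Proof.
move=> av.
have [co_sw sub_sw] : co (s * w)%g w /\ interval_in_coset e v (s * w)%g.
  have [eq_w'|/eqP neq_w'] := eqVneq w' (s * w)%g.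
    rewrite -eq_w'; split=> // x vx xw'.
    by apply: (same_coset_trans e_eq (below vx xw')); apply: same_coset_sym.
  have dw' := desc_w' neq_w'.
  have v_sw' : bruhat_le v (s * w')%g.
    by have [] := lifting ij vw'; rewrite lower_id // lower_desc.
  have sw'_w' : bruhat_le (s * w')%g w'.
    by have := @lower_upper n i j w' ij; rewrite lower_desc // upper_id.
  have co_sw' : co (s * w')%g w by apply: below.
  have co_sw'_sw : co (s * w')%g (s * w)%g by apply: same_coset_mull.
  have co_sw : co (s * w)%g w.
    by apply: (same_coset_trans e_eq _ co_sw'); apply: same_coset_sym.
  split=> //; apply: (IH _ e_eq v_sw') => //.
  - by rewrite lenw.
  - by apply: s_le_sw.
  - by have := ninv_s dw'; move: len; rewrite lenw; lia.
  move=> x vx xw'; apply: (same_coset_trans e_eq _ (same_coset_sym e_eq co_sw)).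
  by apply: below => //; apply: bruhat_le_trans sw'_w'.
move=> x vx xw; case: (ascP x) => [ax|dx].
  by apply: (same_coset_trans e_eq _ co_sw); apply: sub_sw => //; apply: le_sw.
have v_sx : bruhat_le v (s * x)%g.
  by have [] := lifting ij vx; rewrite lower_id // lower_desc.
have /co_s := sub_sw _ v_sx (s_le_sw dx xw).
by rewrite sKK.
Qed.

(** Here the induction hypothesis is applied to [(s v, s w', s w)]. The hypothesis [good] excludes
    [w' = s w], so [w'] descends and [s w'] is shorter. *)
Lemma extend_descent : (v j < v i)%N -> interval_in_coset e v w.
Proof.
move=> dv.
have dw' : (w' j < w' i)%N.
  by apply: desc_w' => /good; rewrite ltnNge (ltnW dv).
have sw'_w' : bruhat_le (s * w')%g w'.
  by have := @lower_upper n i j w' ij; rewrite lower_desc // upper_id.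
have sv_v : bruhat_le (s * v)%g v.
  by have := @lower_upper n i j v ij; rewrite lower_desc // upper_id.
have sub : interval_in_coset e (s * v)%g (s * w)%g.
  apply: (IH _ e_eq (_ : bruhat_le _ (s * w')%g)).
  - by rewrite lenw.
  - by have [] := lifting ij vw'; rewrite !lower_desc.
  - exact: s_le_sw.
  - by have := ninv_s dw'; move: len; rewrite lenw; lia.
  - exact: same_coset_mull.
  move=> u svu usw'.
  have sv_asc : ((s * v)%g i < (s * v)%g j)%N by rewrite !permM tpermL tpermR.
  have sw'_asc : ((s * w')%g i < (s * w')%g j)%N by rewrite !permM tpermL tpermR.
  have := (lifting ij svu).2; have := (lifting ij usw').2.
  rewrite (upper_asc sv_asc) (upper_asc sw'_asc) !sKK.
  case: (ascP u) => [au|du]; [rewrite upper_asc | rewrite upper_id] => // uw' vu.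
    by apply: co_s; apply: below.
  (* Now [u] itself lies in [[v,w']], hence so does [s w']; being equivalent to both [w] and [s w],
     it identifies their classes. *)
  have co_sw' : co (s * w')%g w.
    by apply: below => //; apply: bruhat_le_trans vu usw'.
  apply: (same_coset_trans e_eq (below vu uw')).
  apply: (same_coset_trans e_eq (same_coset_sym e_eq co_sw')).
  exact: same_coset_mull.
move=> x vx xw; case: (ascP x) => [ax|dx]; last first.
  rewrite -[w]sKK; apply: co_s; apply: sub; last exact: s_le_sw.
  by have [] := lifting ij vx; rewrite !lower_desc.
(* The existence of [x] puts [v] into [[s v, s w]], so [v] is equivalent to both [w] and [s w]. *)
have x_sw := le_sw ax xw.
have co_v : co v (s * w)%g by apply: sub => //; apply: bruhat_le_trans vx x_sw.
have co_vw : co v w by apply: below => //; apply: bruhat_le_refl.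
apply: (same_coset_trans e_eq (y := (s * w)%g)).
  by apply: sub => //; apply: bruhat_le_trans sv_v vx.
by apply: (same_coset_trans e_eq _ co_vw); apply: same_coset_sym.
Qed.

Lemma extend_good : interval_in_coset e v w.
Proof. by case: (ascP v); [apply: extend_ascent | apply: extend_descent]. Qed.

End Core.

(** Inversion exchanges positions and values; since every comparison is with [w], pulling [e] back
    along [w] gives the right relation for the inverses. *)
Lemma same_cosetV e x w : equivalence_rel e ->
  same_coset e x w <-> same_coset (relpre w e) x^-1%g w^-1%g.
Proof.
move=> e_eq; split=> h i /=; last by have := h (x i); rewrite /= permK permKV equiv_sym.
by have := h (x^-1%g i); rewrite !permKV equiv_sym.
Qed.

Lemma not_desc1 i j : j = i.+1 :> nat -> ((1 : 'S_n)%g j < (1 : 'S_n)%g i)%N = false.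
Proof. by rewrite !perm1 => ->; lia. Qed.

Lemma bruhat_le1 v : bruhat_le v 1%g -> v = 1%g.
Proof. by move/bruhat_le_inv=> []; rewrite // ninv1. Qed.

(* If [extend_good] applies neither to a descent of [w] nor, after inversion, to a
   descent of [w^-1], then [w'] has no descent, so [v = w' = 1], which is absurd. *)
Lemma interval_coset_extension w : coset_extension w.
Proof.
move: {2}(ninv w).+1 (ltnSn (ninv w)) => m; elim: m w => // m IHm w.
rewrite ltnS => le_m e v w' e_eq vw' w'w len cow' below.
have IH w0 : (ninv w0 < ninv w)%N -> coset_extension w0.
  by move=> lt0; apply: IHm; apply: leq_trans le_m.
have w1 : w != 1%g by apply: contra_eq_neq len => ->; rewrite ninv1.
have [i [j [ij desc]]] := ex_descent w1.
have [[eq_w' dv]|good] := asboolP (w' = (tperm i j * w)%g /\ (v j < v i)%N); last first.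
  apply: (extend_good e_eq ij vw' w'w len cow' below desc _ IH) => eq_w'.
  have neq_ij : i != j by rewrite -val_eqE /= ij neq_ltn leqnn.
  by rewrite ltn_perm_neq //; apply/negP => dv; case: good.
have [[i' [j' [ij' desc' neq_i]]]|uniq_desc] :=
    asboolP (exists i' j', [/\ j' = i'.+1 :> nat, (w j' < w i')%N & i' != i]).
  apply: (extend_good e_eq ij' vw' w'w len cow' below desc' _ IH).
  rewrite eq_w' => /mulIg/permP/(_ i); rewrite tpermL.
  case: tpermP => [ii'|ii'|_ _ ji]; first by rewrite ii' eqxx in neq_i.
    by move=> ji; move: ij ij'; rewrite ji -ii'; lia.
  by move: ij; rewrite ji; lia.
have wV1 : w^-1%g != 1%g by rewrite invg_eq1.
have [k [l [kl descV]]] := ex_descent wV1.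
have [eq_w'V|neq_w'V] := eqVneq w'^-1%g (tperm k l * w^-1)%g.
  suff w'1 : w' = 1%g.
    have v1 : v = 1%g by apply: bruhat_le1; rewrite -w'1.
    by rewrite v1 not_desc1 in dv.
  have w'E : w' = (w * tperm k l)%g by rewrite -[w']invgK eq_w'V invMg invgK tpermV.
  (* [w'] arises from [w] both by exchanging the positions [i, j] and by exchanging the values
     [k, l], so these positions hold these values, in descending order. *)
  have [wi wj] : w i = l /\ w j = k.
    have := w'E; rewrite eq_w' tperm_mul => /mulgI/permP/(_ k).
    rewrite tpermL; case: tpermP => [kE|kE|_ _ kl']; last by move: kl; rewrite -kl'; lia.
      by move=> wj; move: desc; rewrite -kE wj; lia.
    by move=> wi; split.
  apply: perm_increasing1 => i' j' ij'; rewrite w'E !permM.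
  have [ii'|neq_i'] := eqVneq i' i.
    have jj' : j' = j by apply: val_inj => /=; rewrite ij ij' ii'.
    by rewrite ii' jj' wi wj tpermL tpermR kl.
  have asc' : (w i' < w j')%N.
    rewrite ltn_perm_neq; last by rewrite -val_eqE /= ij' neq_ltn leqnn.
    by apply/negP => desc'; apply: uniq_desc; exists i', j'.
  have D (p q : 'I_n) : p <> q -> nat_of_ord p <> q by move=> pq /val_inj.
  move: asc'; case: tpermP => [wi'|wi'|/D ? /D ?]; case: tpermP => [wj'|wj'|/D ? /D ?];
    rewrite ?wi' ?wj'; try lia.
  have ji' : i' = j by apply: (@perm_inj _ w); rewrite wi' wj.
  have ij'' : j' = i by apply: (@perm_inj _ w); rewrite wj' wi.
  by move: ij'; rewrite ji' ij'' ij; lia.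
have e'_eq : equivalence_rel (relpre w e) by move=> x y z; apply: e_eq.
have lenV : ninv w^-1%g = (ninv w'^-1%g).+1 by rewrite !ninvV.
have cow'V := (same_cosetV w' w e_eq).1 cow'.
have belowV x : bruhat_le v^-1%g x -> bruhat_le x w'^-1%g ->
    same_coset (relpre w e) x w^-1%g.
  move=> /bruhat_leV; rewrite invgK => vx /bruhat_leV; rewrite invgK => xw'.
  by rewrite -[x]invgK; apply: (same_cosetV x^-1%g w e_eq).1; apply: below.
have main := @extend_good _ v^-1%g w'^-1%g w^-1%g k l e'_eq kl (bruhat_leV vw')
  (bruhat_leV w'w) lenV cow'V belowV descV.
move=> x /bruhat_leV vx /bruhat_leV xw; apply: (same_cosetV x w e_eq).2; apply: main => //.
  by move=> eq_w'V; rewrite eq_w'V eqxx in neq_w'V.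
by move=> w0; rewrite ninvV; apply: IH.
Qed.

End Extension.

Local Open Scope ring_scope.

(** * The weight cone *)

Section ConeDim.
Variables (R : realType) (n : nat).
Local Notation V := 'rV[R]_n.
Implicit Types (S X : seq V).

Lemma free_span S : exists X, [/\ {subset X <= S}, free X & <<X>>%VS = <<S>>%VS].
Proof.
elim: S => [|u S [X [XS freeX spanX]]]; first by exists [::]; rewrite nil_free.
have [uX|uX] := boolP (u \in <<X>>%VS).
  exists X; split=> // [x /XS xS|]; first by rewrite inE xS orbT.
  by rewrite span_cons -spanX; apply/esym/addv_idPr; rewrite -memvE.
exists (u :: X); split; last by rewrite !span_cons spanX.
  by move=> x; rewrite !inE => /predU1P[->|/XS->]; rewrite ?eqxx ?orbT.
by rewrite free_cons uX freeX.
Qed.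

Lemma mem_cone S u : u \in S -> cone S u.
Proof.
(* The cone sums over a list in which [u] may be repeated, so the coefficient is the inverse of its
   multiplicity. *)
move=> uS; exists (fun x => if x == u then (count_mem u S)%:R^-1 else 0); split.
  by move=> x; case: ifP => _ //; rewrite invr_ge0 ler0n.
transitivity (\sum_(x <- S | x == u) (count_mem u S)%:R^-1 *: u).
  rewrite big_const_seq iter_addr addr0 -scaler_nat scalerA divff ?scale1r //.
  by rewrite pnatr_eq0 -lt0n -has_count; apply/hasP; exists u => /=.
rewrite [LHS]big_mkcond; apply: eq_bigr => x _ /=.
by case: eqP => [->//|_]; rewrite scale0r.
Qed.

Lemma cone_span S u : cone S u -> u \in <<S>>%VS.
Proof.
case=> c [_ ->]; rewrite big_seq; apply: rpred_sum => x xS.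
by apply: rpredZ; apply: memv_span.
Qed.

(** The generators lie in the cone, so a basis of the span can be chosen among them. *)
Lemma cone_dimE S : cone_dim (cone S) = \dim <<S>>%VS.
Proof.
apply/eqP; rewrite eqn_leq; apply/andP; split.
  apply/bigmax_leqP => k /asboolP[X [XS freeX]].
  have := freeX; rewrite /free => /eqP dimX; rewrite size_tuple in dimX.
  rewrite -dimX; apply: dimvS; apply/span_subvP => x /tnthP[i ->].
  exact: cone_span.
have [X [XS freeX spanX]] := free_span S.
have dimX : size X = \dim <<S>>%VS by rewrite -spanX; apply/esym/eqP; move: freeX; rewrite /free.
have ltX : (size X < n.+1)%N.
  rewrite ltnS dimX; apply: leq_trans (dimvS (subvf _)) _.
  by rewrite dimvf /dim /= mul1n.
rewrite -dimX; pose k := Ordinal ltX; rewrite -[size X]/(val k).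
apply: (@leq_bigmax_cond _ _ (fun k : 'I_n.+1 => val k)).
apply/asboolP; exists (in_tuple X); split=> // i.
by apply: mem_cone; apply: XS; rewrite mem_tnth.
Qed.

Local Notation e a := (delta_mx 0 a : V).

Definition weights (v w : 'S_n) : seq V :=
  [seq e (v ij.2) - e ij.1 | ij <- enum {: 'I_n * 'I_n}
         & opp_diagram v ij && bruhat_le (v * tperm (v ij.2) ij.1)%g w].

(** The cells of [opp_diagram v] are the reflections that raise [v]: for [a < b] the cell is
    [(b, v^-1 a)]. Unlike the cone, the span does not see the order of [a] and [b]. *)
Lemma mem_weights v w a b : bruhat_step v (v * tperm a b)%g ->
  bruhat_le (v * tperm a b)%g w -> e a - e b \in <<weights v w>>%VS.
Proof.
wlog ab : a b / (a < b)%N => [main step le_w|step le_w].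
  have [ab|ba|/val_inj ab] := ltngtP a b; first exact: main.
    by rewrite -opprB memvN; apply: main; rewrite // tpermC.
  by rewrite ab subrr mem0v.
have nab : a != b by rewrite -val_eqE /= neq_ltn ab.
move: step; rewrite bruhat_step_tpermE // ab eq_sym eqb_id => pab.
apply: memv_span; apply/mapP; exists (b, v^-1%g a); last by rewrite /= permKV.
by rewrite mem_filter mem_enum /opp_diagram /= permKV ab pab le_w.
Qed.

Lemma weightsP v w u : u \in weights v w -> exists a b,
  [/\ u = e a - e b, bruhat_step v (v * tperm a b)%g & bruhat_le (v * tperm a b)%g w].
Proof.
case/mapP=> -[i j]; rewrite mem_filter /opp_diagram /= => /andP[/andP[/andP[vji jvi] le_w] _] ->.
by exists (v j), i; split=> //; apply: bruhat_step_tperm; rewrite // permK.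
Qed.

Lemma span_equiv (U : {vspace V}) : equivalence_rel (fun a b => e a - e b \in U).
Proof.
move=> a b c; split; first by rewrite subrr mem0v.
move=> abU; rewrite -[e a - e c](subrKA (e b)) //.
by rewrite rpredDl.
Qed.

Lemma cone_dim_cover v w' w : bruhat_le v w' -> bruhat_cover w' w ->
  (cone_dim (@weight_cone R n v w') <= cone_dim (@weight_cone R n v w)
   <= (cone_dim (@weight_cone R n v w')).+1)%N.
Proof.
move=> vw' /bruhat_coverP[w'w len]; rewrite !cone_dimE -!/(weights _ _).
have [c [d [_ _ def_w]]] := bruhat_stepP _ _ w'w.
apply/andP; split.
  apply: dimvS; apply/span_subvP => u /weightsP[a [b [-> step le_w']]].
  by apply: mem_weights => //; apply: bruhat_le_trans le_w' (bruhat_step_le w'w).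
pose U := (<<weights v w'>> + <[e c - e d]>)%VS.
apply: (@leq_trans (\dim U)); last first.
  apply: leq_trans (dimv_add_leqif _ _) _.
  by rewrite dim_vline; case: eqP => _; rewrite ?addn0 ?addn1.
have U_eq := span_equiv U.
have sub1 : (<<weights v w'>> <= U)%VS by apply: addvSl.
have sub2 : e c - e d \in U by apply: subvP (addvSr _ _) _ (memv_line _).
have cow' : same_coset (fun a b => e a - e b \in U) w' w.
  by rewrite def_w; apply/(same_coset_tperm U_eq).
have cov x : bruhat_le v x -> bruhat_le x w' ->
    same_coset (fun a b => e a - e b \in U) x v.
  apply: (same_coset_atoms U_eq) => a b step le_w'.
  by apply: subvP sub1 _ _; apply: mem_weights.
have covw : same_coset (fun a b => e a - e b \in U) v w.
  apply: (same_coset_trans U_eq _ cow'); apply: (same_coset_sym U_eq).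
  by apply: cov => //; apply: bruhat_le_refl.
have cow := interval_coset_extension U_eq vw' (bruhat_step_le w'w) len cow' (fun x vx xw' =>
  same_coset_trans U_eq (cov x vx xw') covw).
apply: dimvS; apply/span_subvP => u /weightsP[a [b [-> step le_w]]].
have := cow _ (bruhat_step_le step) le_w.
move=> cow_t; apply: (same_coset_tperm U_eq v a b).1.
by apply: (same_coset_trans U_eq covw); apply: same_coset_sym.
Qed.

End ConeDim.

(** * Polynomial functions and algebraic independence *)

Section PolynomialFunctions.
Variables (C : numFieldType) (n : nat).
Local Notation M := 'M[C]_n.
Implicit Types (F G : M -> C).

(** Polynomials matter only as functions here, and this form makes substitution of matrix maps an
    induction ([pol_comp]). [meval_pol] and [pol_meval] relate it to the polynomials that define the
    topology. *)
Inductive pol : (M -> C) -> Prop :=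
| PolConst c : pol (fun=> c)
| PolEntry i j : pol (fun g => g i j)
| PolAdd F G : pol F -> pol G -> pol (fun g => F g + G g)
| PolMul F G : pol F -> pol G -> pol (fun g => F g * G g).

Lemma eq_pol F G : F =1 G -> pol F -> pol G.
Proof. by move/funext->. Qed.

Lemma pol_exp F k : pol F -> pol (fun g => F g ^+ k).
Proof.
move=> polF; elim: k => [|k IHk]; first exact: PolConst.
by apply: (@eq_pol (fun g => F g * F g ^+ k)) => [g|]; [rewrite exprS | apply: PolMul].
Qed.

Lemma pol_sum (I : Type) (r : seq I) (P : pred I) (F : I -> M -> C) :
  (forall i, P i -> pol (F i)) -> pol (fun g => \sum_(i <- r | P i) F i g).
Proof.
move=> polF; elim: r => [|i r IHr].
  by apply: (@eq_pol (fun=> 0)) => [g|]; [rewrite big_nil | apply: PolConst].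
have [Pi|nPi] := boolP (P i).
  apply: (@eq_pol (fun g => F i g + \sum_(i <- r | P i) F i g)) => [g|].
    by rewrite big_cons Pi.
  by apply: PolAdd => //; apply: polF.
by apply: eq_pol IHr => g; rewrite big_cons (negPf nPi).
Qed.

Lemma pol_prod (I : Type) (r : seq I) (P : pred I) (F : I -> M -> C) :
  (forall i, P i -> pol (F i)) -> pol (fun g => \prod_(i <- r | P i) F i g).
Proof.
move=> polF; elim: r => [|i r IHr].
  by apply: (@eq_pol (fun=> 1)) => [g|]; [rewrite big_nil | apply: PolConst].
have [Pi|nPi] := boolP (P i).
  apply: (@eq_pol (fun g => F i g * \prod_(i <- r | P i) F i g)) => [g|].
    by rewrite big_cons Pi.
  by apply: PolMul => //; apply: polF.
by apply: eq_pol IHr => g; rewrite big_cons (negPf nPi).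
Qed.

Definition polmx (h : M -> M) := forall i j, pol (fun g => h g i j).

Lemma pol_comp F h : polmx h -> pol F -> pol (F \o h).
Proof.
move=> polh; elim=> [c|i j|F1 F2 _ IH1 _ IH2|F1 F2 _ IH1 _ IH2] /=.
- exact: PolConst.
- exact: polh.
- exact: PolAdd.
- exact: PolMul.
Qed.

Lemma polmx_id : polmx id. Proof. by move=> i j; apply: PolEntry. Qed.

Lemma polmx_const A : polmx (fun=> A).
Proof. by move=> i j; apply: PolConst. Qed.

Lemma polmx_mul h1 h2 : polmx h1 -> polmx h2 -> polmx (fun g => h1 g *m h2 g).
Proof.
move=> p1 p2 i j; apply: (@eq_pol (fun g => \sum_k h1 g i k * h2 g k j)).
  by move=> g; rewrite mxE.
by apply: pol_sum => k _; apply: PolMul.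
Qed.

Lemma polmx_matrix (E : M -> 'I_n -> 'I_n -> C) : (forall i j, pol (fun g => E g i j)) ->
  polmx (fun g => \matrix_(i, j) E g i j).
Proof. by move=> polE i j; apply: eq_pol (polE i j) => g; rewrite mxE. Qed.

Lemma pol_det h : polmx h -> pol (fun g => \det (h g)).
Proof.
move=> polh; apply: pol_sum => s _; apply: PolMul; first exact: PolConst.
by apply: pol_prod => i _; apply: polh.
Qed.

Lemma meval_pol (p : mpoly.mpoly (n * n) C) : pol (fun g => mpoly.meval (mxvec g 0) p).
Proof.
apply: (eq_pol (fun g => esym (mpoly.mevalE (mxvec g 0) p))).
apply: pol_sum => m _; apply: PolMul; first exact: PolConst.
apply: pol_prod => k _; apply: pol_exp; case/mxvec_indexP: k => i j.
by apply: eq_pol (PolEntry i j) => g; rewrite mxvecE.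
Qed.

Lemma pol_meval F : pol F ->
  exists p : mpoly.mpoly (n * n) C, forall g, F g = mpoly.meval (mxvec g 0) p.
Proof.
elim=> [c|i j|F1 F2 _ [p1 E1] _ [p2 E2]|F1 F2 _ [p1 E1] _ [p2 E2]] /=.
- by exists (mpoly.mpolyC (n * n) c) => g; rewrite mpoly.mevalC.
- exists (mpoly.mpolyX C (mpoly.mnm1 (mxvec_index i j))) => g.
  by rewrite mpoly.mevalXU mxvecE.
- by exists (p1 + p2) => g; rewrite mpoly.mevalD E1 E2.
- by exists (p1 * p2) => g; rewrite mpoly.mevalM E1 E2.
Qed.

Lemma pol_line F a b : pol F -> exists q : {poly C}, forall t, F (a + t *: b) = q.[t].
Proof.
elim=> [c|i j|F1 F2 _ [p1 E1] _ [p2 E2]|F1 F2 _ [p1 E1] _ [p2 E2]] /=.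
- by exists c%:P => t; rewrite hornerC.
- by exists ((a i j)%:P + 'X * (b i j)%:P) => t; rewrite !mxE !hornerE.
- by exists (p1 + p2) => t; rewrite hornerD E1 E2.
- by exists (p1 * p2) => t; rewrite hornerM E1 E2.
Qed.

Lemma nat_roots_eq0 (q : {poly C}) k :
  (size q <= k)%N -> (forall i, (i < k)%N -> q.[i%:R] = 0) -> q = 0.
Proof.
move=> le_k roots; apply/eqP/negPn/negP => q0.
suff : (k < size q)%N by rewrite ltnNge le_k.
rewrite -(size_iota 0 k) -(size_map (fun i => i%:R : C)); apply: max_poly_roots => //.
  rewrite all_map; apply/allP => i; rewrite mem_iota add0n => /roots qi.
  by rewrite /= /root qi.
by rewrite map_inj_uniq ?iota_uniq // => i j /eqP; rewrite eqr_nat => /eqP.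
Qed.

Lemma poly_neq0_eval (q : {poly C}) : q != 0 -> exists t, q.[t] != 0.
Proof.
move=> q0; apply: contrapT => noroot; case/eqP: q0.
apply: (@nat_roots_eq0 _ (size q)) => // i _; apply/eqP/negPn/negP => qi.
by apply: noroot; exists i%:R.
Qed.

(** Irreducibility of affine space, by restriction to the line through [a] and [b]. *)
Lemma pol_neq0_mul F G a b : pol F -> pol G -> F a != 0 -> G b != 0 ->
  exists c, F c != 0 /\ G c != 0.
Proof.
move=> polF polG Fa Gb.
have [p Ep] := pol_line a (b - a) polF; have [q Eq] := pol_line a (b - a) polG.
have pq0 : p * q != 0.
  apply: mulf_neq0.
    apply: contra_neq Fa => p0; rewrite -[X in F X]addr0 -(scale0r (b - a)).
    by rewrite Ep p0 horner0.
  apply: contra_neq Gb => q0; rewrite -[b](subrKC a) -(scale1r (b - a)).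
  by rewrite Eq q0 horner0.
have [t] := poly_neq0_eval pq0; rewrite hornerM mulf_eq0 negb_or -Ep -Eq => /andP[].
by exists (a + t *: (b - a)).
Qed.

(** An algebraic passage to the limit [t = 0]; the factor ['X] in the proof takes care of the
    excluded value. *)
Lemma pol_line_eq0 F a b : pol F -> (forall t, t != 0 -> F (a + t *: b) = 0) -> F a = 0.
Proof.
move=> polF F0; have [q Eq] := pol_line a b polF.
suff q0 : q * 'X = 0.
  move/eqP: q0; rewrite mulf_eq0 polyX_eq0 orbF => /eqP q0.
  by rewrite -[a]addr0 -(scale0r b) Eq q0 horner0.
apply: (@nat_roots_eq0 _ (size (q * 'X))) => // i _.
rewrite hornerM hornerX; have [->|i0] := eqVneq (i%:R : C) 0; first by rewrite mulr0.
by rewrite -Eq F0 // mul0r.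
Qed.

End PolynomialFunctions.

(** * Algebraic independence of families of functions *)

Fixpoint exponents (D d : nat) : seq (seq nat) :=
  if d is d'.+1 then [seq k :: e | k <- iota 0 D.+1, e <- exponents D d'] else [:: [::]].

Lemma exponentsS D d : exponents D d.+1 = [seq k :: e | k <- iota 0 D.+1, e <- exponents D d].
Proof. by []. Qed.

Lemma size_exponents D d : size (exponents D d) = (D.+1 ^ d)%N.
Proof. by elim: d => // d IHd; rewrite exponentsS size_allpairs IHd size_iota expnS. Qed.

Lemma exponents_uniq D d : uniq (exponents D d).
Proof.
elim: d => // d IHd; rewrite exponentsS; apply: allpairs_uniq => //; first exact: iota_uniq.
by move=> [k e] [k' e'] _ _ [-> ->].
Qed.

Lemma mem_exponents D d k e : (k :: e \in exponents D d.+1) = (k <= D)%N && (e \in exponents D d).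
Proof.
rewrite exponentsS; apply/allpairsP/andP.
  by case=> -[k' e'] [+ + [-> ->]]; rewrite mem_iota.
by case=> kD ed; exists (k, e); rewrite mem_iota.
Qed.

Lemma nil_notin_exponents D d : ([::] \in exponents D d.+1) = false.
Proof. by apply/negP => /allpairsP[[? ?] []]. Qed.

Lemma exponents_cat D l d e : e \in exponents D (l + d) ->
  exists e1 e2, [/\ e1 \in exponents D l, e2 \in exponents D d & e = e1 ++ e2].
Proof.
elim: l e => [|l IHl] e; first by exists [::], e; rewrite inE.
case: e => [|k e]; rewrite addSn ?nil_notin_exponents // mem_exponents => /andP[kD].
by case/IHl=> e1 [e2 [e1l e2d ->]]; exists (k :: e1), e2; rewrite mem_exponents kD.
Qed.

Section Independence.
Variable C : numFieldType.
Implicit Types (vs t : seq C).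

Fixpoint monomial vs (e : seq nat) : C :=
  match vs, e with v :: vs', k :: e' => v ^+ k * monomial vs' e' | _, _ => 1 end.

(** The value at [vs] of a polynomial with coefficients [c]. Bounding the degree in each variable,
    not the total degree, makes the exponents a product set. *)
Definition eval_coefs D (c : seq nat -> C) vs : C :=
  \sum_(e <- exponents D (size vs)) c e * monomial vs e.

Lemma eval_coefs_cons D c v vs :
  eval_coefs D c (v :: vs) = \sum_(k < D.+1) v ^+ k * eval_coefs D (fun e => c (val k :: e)) vs.
Proof.
rewrite /eval_coefs [size _]/= exponentsS big_allpairs_dep -(big_mkord xpredT (fun k =>
  v ^+ k * \sum_(e <- exponents D (size vs)) c (k :: e) * monomial vs e)).
rewrite /index_iota subn0; apply: eq_bigr => k _; rewrite mulr_sumr.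
by apply: eq_bigr => e _; rewrite /= mulrCA.
Qed.

Lemma eval_coefs_eq0 D c vs : (forall e, e \in exponents D (size vs) -> c e = 0) -> eval_coefs D c vs = 0.
Proof. by move=> c0; rewrite /eval_coefs big_seq big1 // => e /c0->; rewrite mul0r. Qed.

(** As a polynomial in the first free variable the sum has [D.+1] integer roots, so each of its
    coefficients vanishes; these have one free variable less. *)
Lemma eval_coefs_free D c l vs : (forall t, size t = l -> eval_coefs D c (t ++ vs) = 0) ->
  forall e, e \in exponents D l -> eval_coefs D (fun e' => c (e ++ e')) vs = 0.
Proof.
elim: l c => [|l IHl] c comb0 e.
  by rewrite inE => /eqP->; apply: (comb0 [::]).
case: e => [|k e]; rewrite ?nil_notin_exponents // mem_exponents => /andP[kD eB] /=.
apply: (IHl (fun e' => c (k :: e'))) => // t sz_t.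
pose q := \poly_(k < D.+1) eval_coefs D (fun e' => c (k :: e')) (t ++ vs).
suff q0 : q = 0.
  by have := congr1 (fun p : {poly C} => p`_k) q0; rewrite coef_poly coef0 ltnS kD.
apply: (@nat_roots_eq0 _ _ D.+1); first exact: size_poly.
move=> i _; rewrite horner_poly.
rewrite -[RHS](comb0 (i%:R :: t)) /= ?sz_t // eval_coefs_cons.
by apply: eq_bigr => j _; rewrite mulrC.
Qed.

Section Families.
Variables X Y : Type.
Implicit Types (fs : seq (X -> C)) (Z : X -> Prop).

Definition values (T : Type) (fs : seq (T -> C)) (x : T) := [seq f x | f <- fs].

Definition alg_indep (T : Type) (Z : T -> Prop) (fs : seq (T -> C)) :=
  forall D c, (forall x, Z x -> eval_coefs D c (values fs x) = 0) ->
  forall e, e \in exponents D (size fs) -> c e = 0.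

Lemma alg_indep_nil Z : (exists x, Z x) -> alg_indep Z [::].
Proof.
case=> x Zx D c /(_ x Zx); rewrite /eval_coefs big_seq1 mulr1 => c0 e.
by rewrite inE => /eqP->.
Qed.

(* [A] stands for the ring of functions considered: the hypothesis on [Z1] is
   primality of its vanishing ideal, for the powers of [f] only. *)
Lemma alg_indep_cons (A : (X -> C) -> Prop) (Z0 Z1 : X -> Prop) f fs :
  (forall x, Z0 x -> Z1 x) -> (forall x, Z0 x -> f x = 0) ->
  (forall m D c, A (fun x => \sum_(k < D.+1 | (m <= k)%N)
       f x ^+ (k - m) * eval_coefs D (fun e => c (val k :: e)) (values fs x))) ->
  (forall m h, A h -> (forall x, Z1 x -> f x ^+ m * h x = 0) ->
    forall x, Z1 x -> h x = 0) ->
  alg_indep Z0 fs -> alg_indep Z1 (f :: fs).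
Proof.
move=> Z01 f0 Acomb prim indep D c comb0 [|k e]; first by rewrite nil_notin_exponents.
rewrite mem_exponents => /andP[].
(* Once the exponents of [f] below [m] are gone, the relation is divisible by [f ^+ m], and on [Z0]
   only the term [k = m] of the quotient remains. *)
elim/ltn_ind: k e => m IHm e mD eB.
pose h x := \sum_(k < D.+1 | (m <= k)%N)
  f x ^+ (k - m) * eval_coefs D (fun e => c (val k :: e)) (values fs x).
have h0 : forall x, Z1 x -> h x = 0.
  apply: (prim m h); first exact: Acomb.
  move=> x Z1x; rewrite -(comb0 x Z1x) eval_coefs_cons mulr_sumr big_mkcond /=.
  apply: eq_bigr => k _; case: leqP => [mk|km]; first by rewrite mulrA -exprD subnKC.
  rewrite eval_coefs_eq0 ?mulr0 // => e'; rewrite size_map => e'B.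
  by rewrite IHm // (leq_trans (ltnW km)).
apply: (indep D (fun e => c (m :: e))) => // x Z0x.
have mD' : (m < D.+1)%N by [].
have := h0 x (Z01 _ Z0x); rewrite /h (bigD1 (Ordinal mD')) //= subnn expr0 mul1r.
rewrite big1 ?addr0 // => k /andP[mk neq_k]; rewrite f0 // expr0n.
have lt_mk : (m < k)%N by rewrite ltn_neqAle mk andbT eq_sym; exact: neq_k.
by rewrite subn_eq0 leqNgt lt_mk mul0r.
Qed.

(** Over a point [y] the functions [ys] take arbitrary values while [fs] depend on [y] alone, so a
    relation splits into one for each monomial in [ys]. *)
Lemma alg_indep_free Z (Z0 : Y -> Prop) ys fs (gs : seq (Y -> C)) :
  (forall y t, Z0 y -> size t = size ys -> exists x,
    [/\ Z x, values ys x = t & values fs x = values gs y]) ->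
  size fs = size gs -> alg_indep Z0 gs -> alg_indep Z (ys ++ fs).
Proof.
move=> lift sz indep D c comb0 e; rewrite size_cat => /exponents_cat[e1 [e2 [e1B e2B ->]]].
rewrite sz in e2B; apply: (indep D (fun e => c (e1 ++ e))) => // y Z0y.
apply: (eval_coefs_free (l := size ys)) => // t /(lift y t Z0y)[x [Zx <- <-]].
by have := comb0 x Zx; rewrite /values map_cat.
Qed.

End Families.

(** * Algebraic dependence by counting coefficients *)

Section Counting.
Variable n : nat.
Local Notation M := 'M[C]_n.
Implicit Types (F G : M -> C) (I : {set 'I_n * 'I_n}).

Definition set_entry (m : M) i j (t : C) : M :=
  \matrix_(a, b) if (a, b) == (i, j) then t else m a b.

Lemma set_entry_same m i j : set_entry m i j (m i j) = m.
Proof. by apply/matrixP => a b; rewrite mxE; case: eqP => // -[-> ->]. Qed.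

Definition deg_le (E : nat) F := forall m i j,
  exists2 q : {poly C}, (size q <= E.+1)%N & forall t : C, F (set_entry m i j t) = q.[t].

Lemma deg_leW E E' F : (E <= E')%N -> deg_le E F -> deg_le E' F.
Proof.
move=> le_E degF m i j; have [q sz_q Fq] := degF m i j.
by exists q => //; apply: leq_trans sz_q _.
Qed.

Lemma deg_le_const c : deg_le 0 (fun=> c).
Proof. by move=> m i j; exists c%:P => [|t]; rewrite ?size_polyC ?hornerC ?leq_b1. Qed.

Lemma deg_leD E F G : deg_le E F -> deg_le E G -> deg_le E (fun m => F m + G m).
Proof.
move=> degF degG m i j; have [p sz_p Fp] := degF m i j; have [q sz_q Gq] := degG m i j.
exists (p + q) => [|t]; last by rewrite hornerD Fp Gq.
by rewrite (leq_trans (size_polyD _ _)) // geq_max sz_p.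
Qed.

Lemma deg_leM E E' F G : deg_le E F -> deg_le E' G -> deg_le (E + E') (fun m => F m * G m).
Proof.
move=> degF degG m i j; have [p sz_p Fp] := degF m i j; have [q sz_q Gq] := degG m i j.
exists (p * q) => [|t]; last by rewrite hornerM Fp Gq.
rewrite (leq_trans (size_polyMleq _ _)) //.
by move: sz_p sz_q; case: (size p) (size q) => [|a] [|b] /=; rewrite ?addSn ?addnS; lia.
Qed.

Lemma deg_leX E F k : deg_le E F -> deg_le (k * E) (fun m => F m ^+ k).
Proof.
move=> degF; elim: k => [|k IHk]; first exact: deg_le_const.
rewrite mulSn (_ : (fun m => F m ^+ k.+1) = (fun m => F m * F m ^+ k)).
  exact: deg_leM.
by apply/funext => m; rewrite exprS.
Qed.

Lemma deg_le_sum (J : eqType) (r : seq J) E (F : J -> M -> C) :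
  (forall k, k \in r -> deg_le E (F k)) -> deg_le E (fun m => \sum_(k <- r) F k m).
Proof.
elim: r => [|k r IHr] degF.
  rewrite (_ : (fun m => _) = (fun=> 0)); last by apply/funext => m; rewrite big_nil.
  by apply: deg_leW (deg_le_const 0).
rewrite (_ : (fun m => _) = (fun m => F k m + \sum_(k <- r) F k m)).
  by apply: deg_leD; [|apply: IHr => l lr]; apply: degF; rewrite inE ?eqxx ?lr ?orbT.
by apply/funext => m; rewrite big_cons.
Qed.

Lemma pol_deg_le F : pol F -> exists E, deg_le E F.
Proof.
elim=> [c|i j|F1 F2 _ [E1 d1] _ [E2 d2]|F1 F2 _ [E1 d1] _ [E2 d2]].
- by exists 0%N; apply: deg_le_const.
- exists 1%N => m k l; have [ij|ij] := eqVneq (i, j) (k, l).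
    by exists 'X => [|t]; rewrite ?size_polyX // mxE ij eqxx hornerX.
  exists (m i j)%:P => [|t]; first by rewrite size_polyC; case: eqP.
  by rewrite mxE (negPf ij) hornerC.
- exists (E1 + E2)%N; apply: deg_leD; first by apply: deg_leW d1; apply: leq_addr.
  by apply: deg_leW d2; apply: leq_addl.
- by exists (E1 + E2)%N; apply: deg_leM.
Qed.

Definition supported I (m : M) := forall i j, (i, j) \notin I -> m i j = 0.

Definition grid_point E I (x : {ffun {p | p \in I} -> 'I_E.+1}) : M :=
  \matrix_(i, j) if insub (i, j) is Some p then (x p)%:R else 0.

(** The entries in [I] are released from the grid one at a time; [l] lists those already arbitrary.
    In each entry the function is a polynomial of degree at most [E] with [E.+1] roots. *)
Lemma grid_eq0 E I F : deg_le E F ->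
  (forall x : {ffun {p | p \in I} -> 'I_E.+1}, F (grid_point x) = 0) ->
  forall m, supported I m -> F m = 0.
Proof.
move=> degF F0.
suff main (l : seq ('I_n * 'I_n)) m : supported I m ->
    (forall p, p \in I -> p \notin l -> exists2 k, (k <= E)%N & m p.1 p.2 = k%:R) ->
    F m = 0.
  by move=> m supp; apply: (main (enum I)) => // p pI; rewrite mem_enum pI.
elim: l m => [|[i j] l IHl] m supp m_grid.
  have ex p : exists k : 'I_E.+1, p \in I -> m p.1 p.2 = (nat_of_ord k)%:R.
    have [pI|pI] := boolP (p \in I); last by exists ord0.
    have [k kE ->] := m_grid p pI isT.
    by exists (Ordinal (kE : (k < E.+1)%N)).
  have [x xE] := choice ex.
  suff -> : m = grid_point [ffun p : {p | p \in I} => x (val p)] by apply: F0.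
  apply/matrixP => i j; rewrite mxE.
  by case: insubP => [p pI pE|/supp //]; rewrite ffunE pE; apply: (xE (i, j)).
have [ijI|ijI] := boolP ((i, j) \in I); last first.
  apply: IHl => // p pI pl; apply: m_grid; rewrite // inE negb_or pl andbT.
  by apply: contraNneq ijI => <-.
have [q sz_q Fq] := degF m i j.
suff q0 : q = 0 by rewrite -(set_entry_same m i j) Fq q0 horner0.
apply: (@nat_roots_eq0 _ _ E.+1) => // k kE; rewrite -Fq; apply: IHl.
  move=> a b abI; rewrite mxE; case: eqP => [ab|_]; last exact: supp.
  by rewrite ab ijI in abI.
move=> [a b] abI abl; rewrite mxE; case: eqP => [_|/eqP ab]; first by exists k.
by apply: (m_grid (a, b)); rewrite // inE negb_or ab.
Qed.

(** The monomial in the fractions [v / q] with its denominators cleared, so that it stays polynomial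
    in [q] and [vs]. *)
Fixpoint hmonomial D (q : C) vs (e : seq nat) : C :=
  match vs, e with
  | v :: vs', k :: e' => v ^+ k * q ^+ (D - k) * hmonomial D q vs' e'
  | _, _ => 1
  end.

Lemma hmonomialE D q vs e : q != 0 -> e \in exponents D (size vs) ->
  hmonomial D q vs e = monomial [seq v / q | v <- vs] e * q ^+ (D * size vs).
Proof.
move=> q0; elim: vs e => [|v vs IH] e; first by rewrite muln0 mulr1.
case: e => [|k e]; rewrite /size -/(size _) ?nil_notin_exponents // mem_exponents => /andP[kD eB] /=.
rewrite IH // (_ : q ^+ (D * _.+1) = q ^+ k * q ^+ (D - k) * q ^+ (D * size vs)).
  2: by rewrite -!exprD subnKC // mulnS.
rewrite exprMn exprVn.
by field; rewrite expf_neq0.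
Qed.

Lemma deg_le_hmonomial E D Q Fs e : deg_le E Q -> List.Forall (deg_le E) Fs ->
  e \in exponents D (size Fs) ->
  deg_le (size Fs * (D * E)) (fun m => hmonomial D (Q m) (values Fs m) e).
Proof.
move=> degQ degFs; elim: degFs e => [|F Fs' degF _ IH] e.
  by move=> _; apply: deg_le_const.
case: e => [|k e]; rewrite /size -/(size _) ?nil_notin_exponents // mem_exponents => /andP[kD eB].
rewrite mulSn /=; apply: deg_leM; last exact: IH.
by rewrite -(subnKC kD) mulnDl subnKC //; apply: deg_leM; apply: deg_leX.
Qed.

Lemma Forall_deg_le Fs : List.Forall (@pol C n) Fs -> exists E, List.Forall (deg_le E) Fs.
Proof.
elim=> [|F Fs' /pol_deg_le[E1 d1] _ [E2 d2]]; first by exists 0%N.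
exists (E1 + E2)%N; constructor; first by apply: deg_leW d1; apply: leq_addr.
by apply: List.Forall_impl d2 => G; apply: deg_leW; apply: leq_addl.
Qed.

Lemma exists_left_kernel a b (A : 'M[C]_(a, b)) : (b < a)%N -> exists2 u : 'rV_a, u != 0 & u *m A = 0.
Proof.
move=> lt_ba; have : kermx A != 0.
  by rewrite kermx_eq0 /row_free neq_ltn (leq_ltn_trans (rank_leq_col A)).
by case/rowV0Pn => u /sub_kermxP uA u0; exists u.
Qed.

(* A function of degree at most [E] in each entry vanishes on the matrices supported
   on [I] as soon as it vanishes on a grid of [E.+1 ^ #|I|] points, which for large
   [D] is less than the number [D.+1 ^ size Fs] of coefficients [c]. *)
Lemma alg_dependence I Fs Q : (#|I| < size Fs)%N -> List.Forall (@pol C n) Fs -> pol Q ->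
  exists D c, (exists2 e, e \in exponents D (size Fs) & c e != 0) /\
    forall m, supported I m -> Q m != 0 ->
      eval_coefs D c [seq v / Q m | v <- values Fs m] = 0.
Proof.
move=> lt_I polFs polQ.
have [E0 FQ] := Forall_deg_le (List.Forall_cons _ polQ polFs).
have degQ := List.Forall_inv FQ; have degFs := List.Forall_inv_tail FQ.
set d := size Fs in lt_I *; set l := #|I| in lt_I.
(* [E] bounds the degrees of the homogenized monomials, and [E + 1 <= (d E0 + 1) (D + 1)]. As
   [D + 1 > (d E0 + 1)^l], there are fewer than [(D + 1)^(l + 1)] grid points, hence fewer than
   coefficients. *)
pose D := ((d * E0).+1 ^ l)%N; pose E := (d * (D * E0))%N.
have count : (E.+1 ^ l < D.+1 ^ d)%N.
  apply: (@leq_trans (D.+1 ^ l.+1)); last by rewrite leq_pexp2l.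
  have le_E : (E.+1 <= (d * E0).+1 * D.+1)%N by rewrite /E; nia.
  rewrite expnS; apply: (@leq_ltn_trans (((d * E0).+1 * D.+1) ^ l)).
    by have [->|l0] := posnP l; rewrite // leq_exp2r.
  by rewrite expnMn ltn_pmul2r ?expn_gt0.
pose B := exponents D d; pose T : finType := {ffun {p | p \in I} -> 'I_E.+1}.
pose A : 'M[C]_(size B, #|T|) := \matrix_(k, x)
  (let m := grid_point (enum_val x) in hmonomial D (Q m) (values Fs m) (nth [::] B k)).
have [|u u0 uA] := exists_left_kernel A.
  by rewrite size_exponents card_ffun card_ord card_sig.
pose c e := if insub (index e B) is Some k then u 0 k else 0.
have c_nth (k : 'I_(size B)) : c (nth [::] B k) = u 0 k.
  by rewrite /c index_uniq ?exponents_uniq // valK.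
have sum_c (f : seq nat -> C) : \sum_(e <- B) c e * f e = \sum_k u 0 k * f (nth [::] B k).
  rewrite (big_nth [::]) big_mkord; apply: eq_bigr => k _.
  by rewrite c_nth.
exists D, c; split.
  have [k uk] : exists k, u 0 k != 0.
    apply/existsP; apply: contraNT u0 => /existsPn u0; apply/eqP/rowP => k.
    by rewrite mxE; apply/eqP; have := u0 k; rewrite negbK.
  by exists (nth [::] B k); rewrite ?mem_nth // c_nth.
pose H m := \sum_(e <- B) c e * hmonomial D (Q m) (values Fs m) e.
have H0 : forall m, supported I m -> H m = 0.
  apply: (@grid_eq0 E) => [|x].
    apply: deg_le_sum => e eB; rewrite -[E]add0n; apply: deg_leM; first exact: deg_le_const.
    exact: deg_le_hmonomial.
  have := congr1 (fun B : 'rV_#|T| => B 0 (enum_rank x)) uA.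
  rewrite !mxE => uA0; rewrite /H sum_c -[RHS]uA0; apply: eq_bigr => k _.
  by rewrite [A _ _]mxE enum_rankK.
move=> m suppm Qm; apply: (@mulIf _ (Q m ^+ (D * d))); first by rewrite expf_neq0.
rewrite mul0r -(H0 m suppm) /eval_coefs /H !size_map mulr_suml big_seq [RHS]big_seq.
apply: eq_bigr => e eB; rewrite -mulrA hmonomialE ?size_map //.
Qed.

End Counting.

End Independence.

(** * Triangular factorizations and the big cell *)

Section Triangular.
Variables (C : fieldType) (n : nat).
Local Notation M := 'M[C]_n.

Lemma trig_unit_diag (A : M) i : A \in unitmx -> is_trig_mx A -> A i i != 0.
Proof.
rewrite unitmxE unitfE => + trA; rewrite (det_trig trA) => /prodf_neq0 A0.
exact: A0.
Qed.

Lemma trig_invmx (A : M) : A \in unitmx -> is_trig_mx A -> is_trig_mx (invmx A).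
Proof.
move=> uA trA; apply/is_trig_mxP => i j.
have [m] := ubnP (nat_of_ord i); elim: m i => // m IHm i lt_im lt_ij.
have := congr1 (fun B : M => B i j) (mulmxV uA); rewrite !mxE.
rewrite (bigD1 i) //= big1 => [|k neq_ki].
  rewrite addr0 (_ : (i == j) = false); last by rewrite -val_eqE /= ltn_eqF.
  by move/eqP; rewrite mulf_eq0 (negPf (trig_unit_diag i uA trA)) => /eqP.
have [lt_ki|lt_ik|/val_inj eq_ki] := ltngtP k i.
- by rewrite (IHm k) ?mulr0 //; [apply: leq_trans lt_ki _ | apply: ltn_trans lt_ij].
- by rewrite (is_trig_mxP trA) ?mul0r.
- by rewrite eq_ki eqxx in neq_ki.
Qed.

Lemma trig_mulmx (A B : M) : is_trig_mx A -> is_trig_mx B -> is_trig_mx (A *m B).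
Proof.
move=> /is_trig_mxP trA /is_trig_mxP trB; apply/is_trig_mxP => i j lt_ij.
rewrite mxE big1 // => k _; have [lt_ik|le_ki] := ltnP i k; first by rewrite trA ?mul0r.
by rewrite trB ?mulr0 //; apply: leq_ltn_trans lt_ij.
Qed.

Lemma borelM (A B : M) : borel A -> borel B -> borel (A *m B).
Proof.
case=> uA tA [uB tB]; split; first by rewrite unitmx_mul uA.
by rewrite trmx_mul; apply: trig_mulmx.
Qed.

Lemma borelV (A : M) : borel A -> borel (invmx A).
Proof.
by case=> uA tA; split; rewrite ?unitmx_inv // trmx_inv; apply: trig_invmx; rewrite ?unitmx_tr.
Qed.

Lemma borel1 : borel (1%:M : M).
Proof. by split; rewrite ?unitmx1 // trmx1; apply: scalar_mx_is_trig. Qed.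

Lemma borel_upper (A : M) (i j : 'I_n) : borel A -> (j < i)%N -> A i j = 0.
Proof. by case=> _ /is_trig_mxP tA lt_ji; have := tA j i lt_ji; rewrite mxE. Qed.

Lemma borel_diag (A : M) i : borel A -> A i i != 0.
Proof.
case=> uA tA; have := trig_unit_diag i _ tA; rewrite unitmx_tr mxE; exact.
Qed.

Definition unip (P : rel 'I_n) (X : M) :=
  (forall i, X i i = 1) /\ (forall i j, i != j -> ~~ P i j -> X i j = 0).

Lemma unip1 P : unip P 1%:M.
Proof. by split=> [i|i j ij _]; rewrite mxE ?eqxx // (negPf ij). Qed.

Lemma unip_sub (P Q : rel 'I_n) X : (forall i j, P i j -> Q i j) -> unip P X -> unip Q X.
Proof.
by move=> PQ [X1 X0]; split=> // i j ij nQ; apply: X0 => //; apply: contra nQ; apply: PQ.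
Qed.

Lemma unip_lower X : unip (fun i j => (j < i)%N) X -> X \in unitmx /\ is_trig_mx X.
Proof.
case=> X1 X0; have tX : is_trig_mx X.
  by apply/is_trig_mxP => i j ij; apply: X0; rewrite -?leqNgt ?(ltnW ij) // -val_eqE /= ltn_eqF.
by split=> //; rewrite unitmxE det_trig // big1 ?unitr1.
Qed.

Lemma unip_upper X : unip (fun i j => (i < j)%N) X -> borel X.
Proof.
case=> X1 X0; have [] := @unip_lower X^T; last by rewrite unitmx_tr.
by split=> [i|i j ij nji]; rewrite mxE // X0 // eq_sym.
Qed.

Section Factor.
Variable rho : 'I_n -> nat.
Variable S : rel 'I_n.
Local Notation gt := (fun i j => (rho j < rho i)%N).
Local Notation gtS := (fun i j => (rho j < rho i)%N && S i j).
Local Notation gtN := (fun i j => (rho j < rho i)%N && ~~ S i j).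

(** The source of the recursions below: the sum involves only pairs whose gap in [rho] is smaller
    than that of [(i, j)]. *)
Lemma unip_mul_entry (A D : M) i j : unip gt A -> unip gt D -> i != j ->
  (A *m D) i j = A i j + D i j + \sum_(k | (rho j < rho k < rho i)%N) A i k * D k j.
Proof.
move=> [A1 A0] [D1 D0] ij; rewrite mxE (bigD1 i) // (bigD1 j) 1?eq_sym //= A1 D1.
rewrite mul1r mulr1 addrA [D i j + _]addrC; congr (_ + _).
rewrite big_mkcond [RHS]big_mkcond /=; apply: eq_bigr => k _.
have [->|ki] := eqVneq k i; first by rewrite ltnn andbF.
have [->|kj] := eqVneq k j; first by rewrite ltnn.
have [le_k|lt_k /=] := leqP (rho k) (rho j).
  by rewrite D0 ?mulr0 // -leqNgt.
have [le_k|//] := leqP (rho i) (rho k).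
by rewrite A0 ?mul0r 1?eq_sym // -leqNgt.
Qed.

Lemma unip_mul (A D : M) : unip gt A -> unip gt D -> unip gt (A *m D).
Proof.
move=> uA uD; split=> [i|i j ij].
  case: uA uD => [A1 A0] [D1 D0]; rewrite mxE (bigD1 i) //= A1 D1 mulr1 big1 ?addr0 // => k ki.
  have [le_k|lt_k] := leqP (rho k) (rho i); first by rewrite D0 ?mulr0 // -leqNgt.
  by rewrite A0 ?mul0r 1?eq_sym // -leqNgt ltnW.
rewrite -leqNgt => le_ij; rewrite unip_mul_entry //.
case: uA uD => [_ A0] [_ D0]; rewrite A0 ?D0 -?leqNgt // !add0r big_pred0 // => k; lia.
Qed.

Lemma gtS_sub (A : M) : unip gtS A -> unip gt A.
Proof. by apply: unip_sub => i j /andP[]. Qed.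

Lemma gtN_sub (A : M) : unip gtN A -> unip gt A.
Proof. by apply: unip_sub => i j /andP[]. Qed.

(** Solved by increasing gap [rho i - rho j]: at each entry [S] forces one of [A i j], [D i j] to
    vanish, and the product formula gives the other. *)
Lemma unip_factor X : unip gt X ->
  exists A D, [/\ unip gtS A, unip gtN D & X = A *m D].
Proof.
move=> uX.
suff approx m : exists A D, [/\ unip gtS A, unip gtN D &
    forall i j, (rho i <= rho j + m)%N -> X i j = (A *m D) i j].
  (* The sum of all values of [rho] bounds every gap. *)
  have [A [D [uA uD XAD]]] := approx (\sum_i rho i)%N.
  exists A, D; split=> //; apply/matrixP => i j; apply: XAD.
  by rewrite (bigD1 i) //= addnCA leq_addr.
elim: m => [|m [A [D [uA uD XAD]]]].
  exists 1%:M, 1%:M; split; [exact: unip1 | exact: unip1 |].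
  move=> i j; rewrite addn0 mulmx1 mxE => le_ij; case: uX => X1 X0.
  by case: eqP => [->|/eqP ij]; [rewrite X1 | rewrite X0 // -leqNgt].
pose N := X - A *m D.
pose A' : M := \matrix_(i, j) (A i j + (N i j) *+ ((rho i == rho j + m.+1)%N && S i j)).
pose D' : M := \matrix_(i, j) (D i j + (N i j) *+ ((rho i == rho j + m.+1)%N && ~~ S i j)).
have rho_neq i j : rho i = (rho j + m.+1)%N -> i != j.
  by move=> ij; apply: contraPneq ij => ->; lia.
have rho_S i : (rho i == rho i + m.+1)%N = false by apply/eqP; lia.
have uA' : unip gtS A'.
  case: uA => A1 A0; split=> [i|i j ij nS]; rewrite mxE.
    by rewrite A1 rho_S mulr0n addr0.
  rewrite A0 // add0r; case: eqP => // rho_ij; move: nS.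
  by rewrite rho_ij addnS ltnS leq_addr => /negPf->.
have uD' : unip gtN D'.
  case: uD => D1 D0; split=> [i|i j ij nS]; rewrite mxE.
    by rewrite D1 rho_S mulr0n addr0.
  rewrite D0 // add0r; case: eqP => // rho_ij; move: nS.
  by rewrite rho_ij addnS ltnS leq_addr => /negPf->.
exists A', D'; split=> // i j le_ij.
have [<-|ij] := eqVneq i j.
  by rewrite (unip_mul (gtS_sub uA') (gtN_sub uD')).1 uX.1.
rewrite (unip_mul_entry (gtS_sub uA') (gtN_sub uD')) //.
have -> : \sum_(k | (rho j < rho k < rho i)%N) A' i k * D' k j =
    \sum_(k | (rho j < rho k < rho i)%N) A i k * D k j.
  apply: eq_bigr => k k_btw; rewrite !mxE.
  rewrite (_ : (rho i == rho k + m.+1)%N = false); last by apply/eqP; lia.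
  by rewrite (_ : (rho k == rho j + m.+1)%N = false) ?mulr0n ?addr0 //; apply/eqP; lia.
have := unip_mul_entry (gtS_sub uA) (gtN_sub uD) ij.
rewrite /A' /D' ![(\matrix_(_, _) _) i j]mxE.
have [rho_ij|neq_ij] := eqVneq (rho i) (rho j + m.+1)%N; last first.
  by rewrite !addr0 => <-; apply: XAD; lia.
have -> : N i j = X i j - (A *m D) i j by rewrite !mxE.
by move=> ->; case: (S i j) => /=; rewrite ?mulr0n ?mulr1n; ring.
Qed.

Lemma unip_factor_unique (A D A' D' : M) :
  unip gtS A -> unip gtN D -> unip gtS A' -> unip gtN D' ->
  A *m D = A' *m D' -> A = A' /\ D = D'.
Proof.
move=> uA uD uA' uD' eqAD.
suff main m i j : (rho i <= rho j + m)%N -> A i j = A' i j /\ D i j = D' i j.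
  by split; apply/matrixP => i j; case: (main (rho i) i j) => //; apply: leq_addl.
elim: m i j => [|m IHm] i j le_ij.
  have [<-|ij] := eqVneq i j; first by rewrite uA.1 uA'.1 uD.1 uD'.1.
  by rewrite (gtS_sub uA).2 ?(gtS_sub uA').2 ?(gtN_sub uD).2 ?(gtN_sub uD').2 // -leqNgt -[rho j]addn0.
have [le_m|lt_m] := leqP (rho i) (rho j + m); first exact: IHm.
have ij : i != j by apply: contraTneq lt_m => ->; lia.
have := congr1 (fun B : M => B i j) eqAD.
rewrite (unip_mul_entry (gtS_sub uA) (gtN_sub uD)) //.
rewrite (unip_mul_entry (gtS_sub uA') (gtN_sub uD')) //.
rewrite (eq_bigr (fun k => A' i k * D' k j)) => [/addIr|k k_btw]; last first.
  have [le_ik le_kj] : (rho i <= rho k + m)%N /\ (rho k <= rho j + m)%N by lia.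
  by rewrite (IHm i k le_ik).1 (IHm k j le_kj).2.
have [Sij|nSij] := boolP (S i j).
  by rewrite uD.2 ?uD'.2 ?Sij ?andbF // !addr0.
by rewrite uA.2 ?uA'.2 ?(negPf nSij) ?andbF // !add0r.
Qed.

End Factor.

Section LU.
Implicit Types L R h : M.
Local Notation low := (fun i j : 'I_n => (j < i)%N).

Lemma LU_entry_upper L R (i j : 'I_n) : unip low L -> borel R -> (i <= j)%N ->
  (L *m R) i j = R i j + \sum_(k < n | (k < i)%N) L i k * R k j.
Proof.
move=> [L1 L0] bR le_ij; rewrite mxE (bigD1 i) //= L1 mul1r; congr (_ + _).
rewrite big_mkcond [RHS]big_mkcond /=; apply: eq_bigr => k _.
have [->|ki] := eqVneq k i; first by rewrite ltnn.
by have [//|le_ik] := ltnP k i; rewrite L0 ?mul0r 1?eq_sym // -leqNgt.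
Qed.

Lemma LU_entry_lower L R (i j : 'I_n) : unip low L -> borel R -> (j < i)%N ->
  (L *m R) i j = L i j * R j j + \sum_(k < n | (k < j)%N) L i k * R k j.
Proof.
move=> uL bR lt_ji; rewrite mxE (bigD1 j) //=; congr (_ + _).
rewrite big_mkcond [RHS]big_mkcond /=; apply: eq_bigr => k _.
have [->|kj] := eqVneq k j; first by rewrite ltnn.
have [//|le_jk] := ltnP k j; rewrite (borel_upper bR) ?mulr0 //.
by rewrite ltn_neqAle le_jk andbT eq_sym.
Qed.

(** Row [k] of [R], then column [k] of [L], are determined by the preceding ones, since the diagonal
    of [R] has no zero. *)
Lemma LU_unique L R L' R' : unip low L -> borel R -> unip low L' -> borel R' ->
  L *m R = L' *m R' -> L = L' /\ R = R'.
Proof.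
move=> uL bR uL' bR' eqLR.
suff main (k : 'I_n) : (forall j, R k j = R' k j) /\ (forall i, L i k = L' i k).
  by split; apply/matrixP => i j; [apply: (main j).2 | apply: (main i).1].
have [m] := ubnP (nat_of_ord k); elim: m k => // m IHm k; rewrite ltnS => le_km.
have IH (l : 'I_n) : (l < k)%N -> (forall j, R l j = R' l j) /\ (forall i, L i l = L' i l).
  by move=> lt_lk; apply: IHm; apply: leq_trans le_km.
have rowR j : R k j = R' k j.
  have [le_kj|lt_jk] := leqP k j; last by rewrite !borel_upper.
  have := congr1 (fun B : M => B k j) eqLR; rewrite !LU_entry_upper //.
  rewrite (eq_bigr (fun l : 'I_n => L' k l * R' l j)) => [/addIr//|l lt_lk].
  by rewrite (IH l lt_lk).1 (IH l lt_lk).2.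
split=> // i; have [lt_ki|le_ik] := ltnP k i.
  have := congr1 (fun B : M => B i k) eqLR; rewrite !LU_entry_lower //.
  rewrite (eq_bigr (fun l : 'I_n => L' i l * R' l k)) => [/addIr|l lt_lk].
    by rewrite rowR; apply: mulIf; apply: borel_diag.
  by rewrite (IH l lt_lk).1 (IH l lt_lk).2.
have [->|ik] := eqVneq i k; first by rewrite uL.1 uL'.1.
by rewrite uL.2 ?uL'.2 // -leqNgt.
Qed.

(* The determinant of [leading k h] is the leading principal minor of size [k]. *)
Definition leading (k : nat) h : M :=
  \matrix_(a, b) if (a < k)%N then h a b else (a == b)%:R.

Lemma LU_exists h : (forall k, (k <= n)%N -> \det (leading k h) != 0) ->
  exists L R, [/\ unip low L, borel R & h = L *m R].
Proof.
move=> minors.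
(* Row operations clearing [h] below the diagonal: the first [i] entries of [z i] combine the first
   [i] rows of [h] into minus row [i] on the columns before [i]. There the identity rows of
   [leading i h] contribute nothing. *)
pose z (i : 'I_n) := - row i h *m invmx (leading i h).
pose Y : M := \matrix_(i, a) if (a < i)%N then z i 0 a else (a == i)%:R.
have uY : unip low Y.
  split=> [i|i j ij /negPf nlt]; rewrite mxE; first by rewrite ltnn eqxx.
  by rewrite nlt eq_sym (negPf ij).
have [unitY trY] := unip_lower uY.
have h_unit : h \in unitmx.
  have := minors n (leqnn n); rewrite (_ : leading n h = h) ?unitmxE ?unitfE //.
  by apply/matrixP => a b; rewrite mxE ltn_ord.
have Yh0 (i j : 'I_n) : (j < i)%N -> (Y *m h) i j = 0.
  move=> lt_ji; have unit_i : leading i h \in unitmx by rewrite unitmxE unitfE minors // ltnW.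
  have := congr1 (fun B : 'rV_n => B 0 j) (mulmxKV unit_i (- row i h)).
  rewrite -/(z i) !mxE => zE.
  have -> : \sum_a Y i a * h a j = \sum_(a | a != i) Y i a * h a j + h i j.
    by rewrite (bigD1 i) //= uY.1 mul1r addrC.
  apply/eqP; rewrite addr_eq0; apply/eqP; rewrite -zE.
  rewrite big_mkcond; apply: eq_bigr => a _; rewrite !mxE.
  have [lt_ai|le_ia] := ltnP a i; first by rewrite -val_eqE /= ltn_eqF.
  rewrite (_ : (a == j) = false) ?mulr0; last first.
    by apply/negbTE; apply: contraTneq le_ia => ->; rewrite -ltnNge.
  by case: eqVneq => //= ai; rewrite mul0r.
exists (invmx Y), (Y *m h); split; last by rewrite mulKmx.
  have trV := trig_invmx unitY trY; split=> [i|i j ij nlt]; last first.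
    by apply: (is_trig_mxP trV); rewrite ltn_neqAle leqNgt nlt andbT; exact: ij.
  have := congr1 (fun B : M => B i i) (mulmxV unitY); rewrite !mxE eqxx.
  rewrite (bigD1 i) //= uY.1 mul1r big1 ?addr0 // => k ki.
  have [lt_ki|le_ik] := ltnP k i; first by rewrite (is_trig_mxP trV) ?mulr0.
  by rewrite uY.2 ?mul0r 1?eq_sym // -leqNgt.
split; first by rewrite unitmx_mul unitY.
by apply/is_trig_mxP => i j lt_ij; rewrite mxE Yh0.
Qed.

Lemma LU_minors L R k : unip low L -> borel R -> \det (leading k (L *m R)) != 0.
Proof.
move=> uL bR.
have leadL : unip low (leading k L).
  split=> [i|i j ij nlt]; rewrite mxE; first by rewrite uL.1 eqxx if_same.
  by rewrite uL.2 // (negPf ij) if_same.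
have -> : leading k (L *m R) = leading k L *m leading k R.
  apply/matrixP => a b; rewrite !mxE; have [lt_ak|le_ka] := ltnP a k.
    apply: eq_bigr => l _; rewrite !mxE lt_ak; have [//|le_kl] := ltnP l k.
    have neq_al : a != l by rewrite -val_eqE /= ltn_eqF // (leq_trans lt_ak).
    by rewrite uL.2 ?mul0r // -leqNgt (leq_trans (ltnW lt_ak)).
  rewrite (bigD1 a) //= !mxE ltnNge le_ka /= eqxx mul1r big1 ?addr0 // => l la.
  by rewrite mxE ltnNge le_ka /= eq_sym (negPf la) mul0r.
have [unitL _] := unip_lower leadL.
rewrite det_mulmx mulf_neq0 //; first by move: unitL; rewrite unitmxE unitfE.
rewrite -det_tr det_trig; last first.
  apply/is_trig_mxP => i j lt_ij; rewrite !mxE.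
  by case: ifP => _; [apply: borel_upper | rewrite -val_eqE /= gtn_eqF].
apply/prodf_neq0 => i _; rewrite !mxE; case: ifP => _; first exact: borel_diag.
by rewrite eqxx oner_eq0.
Qed.

End LU.

End Triangular.

(** * Regular functions on a set of matrices *)

Section Regular.
Variables (C : numFieldType) (n : nat).
Local Notation M := 'M[C]_n.
Variable O : M -> Prop.
Implicit Types F G P Q : M -> C.

(** One fraction valid on all of [O]: its numerator then gives a global equation for the zeros of
    [F] in [O]. *)
Definition reg F := exists P Q, [/\ pol P, pol Q &
  forall g, O g -> Q g != 0 /\ F g = P g / Q g].

Lemma eq_reg F G : (forall g, O g -> F g = G g) -> reg F -> reg G.
Proof.
move=> FG [P [Q [pP pQ FE]]]; exists P, Q; split=> // g Og.
by rewrite -FG //; apply: FE.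
Qed.

Lemma pol_reg F : pol F -> reg F.
Proof.
move=> pF; exists F, (fun=> 1); split=> // [|g _]; first exact: PolConst.
by rewrite oner_eq0 divr1.
Qed.

Lemma regD F G : reg F -> reg G -> reg (fun g => F g + G g).
Proof.
move=> [P [Q [pP pQ FE]]] [P' [Q' [pP' pQ' GE]]].
exists (fun g => P g * Q' g + P' g * Q g), (fun g => Q g * Q' g); split.
- by apply: PolAdd; apply: PolMul.
- exact: PolMul.
move=> g Og; have [[Q0 ->] [Q0' ->]] := (FE g Og, GE g Og).
by rewrite mulf_neq0 //; split=> //; field; rewrite Q0 Q0'.
Qed.

Lemma regM F G : reg F -> reg G -> reg (fun g => F g * G g).
Proof.
move=> [P [Q [pP pQ FE]]] [P' [Q' [pP' pQ' GE]]].
exists (fun g => P g * P' g), (fun g => Q g * Q' g); split; try exact: PolMul.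
move=> g Og; have [[Q0 ->] [Q0' ->]] := (FE g Og, GE g Og).
by rewrite mulf_neq0 //; split=> //; field; rewrite Q0 Q0'.
Qed.

Lemma regB F G : reg F -> reg G -> reg (fun g => F g - G g).
Proof.
move=> rF rG; apply: (@eq_reg (fun g => F g + -1 * G g)).
  by move=> g _; rewrite mulN1r.
by apply: regD => //; apply: regM => //; apply/pol_reg/PolConst.
Qed.

Lemma regV F : (forall g, O g -> F g != 0) -> reg F -> reg (fun g => (F g)^-1).
Proof.
move=> F0 [P [Q [pP pQ FE]]]; exists Q, P; split=> // g Og.
have := F0 g Og; have [Q0 ->] := FE g Og.
by rewrite mulf_eq0 negb_or invf_div => /andP[].
Qed.

Lemma reg_sum (I : Type) (r : seq I) (P : pred I) (F : I -> M -> C) :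
  (forall i, P i -> reg (F i)) -> reg (fun g => \sum_(i <- r | P i) F i g).
Proof.
move=> rF; elim: r => [|i r IHr].
  apply: (@eq_reg (fun=> 0)) => [g _|]; first by rewrite big_nil.
  by apply/pol_reg/PolConst.
have [Pi|nPi] := boolP (P i).
  apply: (@eq_reg (fun g => F i g + \sum_(i <- r | P i) F i g)) => [g _|].
    by rewrite big_cons Pi.
  by apply: regD => //; apply: rF.
by apply: eq_reg IHr => g _; rewrite big_cons (negPf nPi).
Qed.

Lemma reg_comp F (h : M -> M) : (forall i j, reg (fun g => h g i j)) -> pol F ->
  reg (fun g => F (h g)).
Proof.
move=> rh; elim=> [c|i j|F1 F2 _ IH1 _ IH2|F1 F2 _ IH1 _ IH2].
- by apply/pol_reg/PolConst.
- exact: rh.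
- exact: regD.
- exact: regM.
Qed.

Section RegFactor.
Variables (rho : 'I_n -> nat) (S : rel 'I_n) (X A D : M -> M).
Hypothesis uA : forall g, O g -> unip (fun i j => (rho j < rho i)%N && S i j) (A g).
Hypothesis uD : forall g, O g -> unip (fun i j => (rho j < rho i)%N && ~~ S i j) (D g).
Hypothesis XE : forall g, O g -> X g = A g *m D g.
Hypothesis regX : forall i j, reg (fun g => X g i j).

(** The entry formula solves for [A] and [D] by increasing gap from the entries of [X], so both are
    regular however they were chosen. *)
Lemma reg_factor i j : reg (fun g => A g i j) /\ reg (fun g => D g i j).
Proof.
suff main m : (rho i <= rho j + m)%N -> reg (fun g => A g i j) /\ reg (fun g => D g i j).
  by apply: (main (rho i)); apply: leq_addl.
elim: m i j => [|m IHm] i j le_ij.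
  have cst (Z : M -> M) : (forall g, O g -> unip (fun i j => (rho j < rho i)%N) (Z g)) ->
      reg (fun g => Z g i j).
    move=> uZ; apply: (@eq_reg (fun=> (i == j)%:R)); last by apply/pol_reg/PolConst.
    move=> g /uZ[Z1 Z0]; case: eqVneq => [->|ij]; first by rewrite Z1.
    by rewrite Z0 // -leqNgt -[rho j]addn0.
  by split; apply: cst => g Og; [apply: gtS_sub (uA Og) | apply: gtN_sub (uD Og)].
have [le_m|lt_m] := leqP (rho i) (rho j + m); first exact: IHm.
have ij : i != j by apply: contraTneq lt_m => ->; lia.
pose mid g := \sum_(k | (rho j < rho k < rho i)%N) A g i k * D g k j.
have rmid : reg mid.
  apply: reg_sum => k k_btw.
  have [le_ik le_kj] : (rho i <= rho k + m)%N /\ (rho k <= rho j + m)%N by lia.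
  by apply: regM; [apply: (IHm i k le_ik).1 | apply: (IHm k j le_kj).2].
have entry g : O g -> A g i j + D g i j = X g i j - mid g.
  move=> Og; rewrite XE // (unip_mul_entry (gtS_sub (uA Og)) (gtN_sub (uD Og))) //.
  by rewrite addrK.
have r0 (F : M -> C) : (forall g, O g -> F g = 0) -> reg F.
  by move=> F0; apply: (@eq_reg (fun=> 0)) => [g /F0->//|]; apply/pol_reg/PolConst.
have [Sij|nSij] := boolP (S i j).
  have D0 g : O g -> D g i j = 0 by move=> /uD[_ ->]; rewrite // Sij andbF.
  split; last exact: r0.
  apply: eq_reg (regB (regX i j) rmid) => g Og.
  by rewrite -entry // D0 // addr0.
have A0 g : O g -> A g i j = 0 by move=> /uA[_ ->]; rewrite // (negPf nSij) andbF.
split; first exact: r0.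
apply: eq_reg (regB (regX i j) rmid) => g Og.
by rewrite -entry // A0 // add0r.
Qed.

End RegFactor.

Section RegLU.
Variables (h L R : M -> M).
Hypothesis uL : forall g, O g -> unip (fun i j : 'I_n => (j < i)%N) (L g).
Hypothesis bR : forall g, O g -> borel (R g).
Hypothesis hE : forall g, O g -> h g = L g *m R g.
Hypothesis regh : forall i j, reg (fun g => h g i j).

Lemma reg_LU i j : reg (fun g => L g i j).
Proof.
suff main (k : 'I_n) : (forall j, reg (fun g => R g k j)) /\ (forall i, reg (fun g => L g i k)).
  exact: (main j).2.
have [m] := ubnP (nat_of_ord k); elim: m k => // m IHm k; rewrite ltnS => le_km.
have IH (l : 'I_n) : (l < k)%N ->
    (forall j, reg (fun g => R g l j)) /\ (forall i, reg (fun g => L g i l)).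
  by move=> lt_lk; apply: IHm; apply: leq_trans le_km.
have cst c (F : M -> C) : (forall g, O g -> F g = c) -> reg F.
  by move=> Fc; apply: (@eq_reg (fun=> c)) => [g /Fc->//|]; apply/pol_reg/PolConst.
have rsum a b : reg (fun g => \sum_(l < n | (l < k)%N) L g a l * R g l b).
  by apply: reg_sum => l lt_lk; have [rR rL] := IH l lt_lk; apply: regM.
have rowR b : reg (fun g => R g k b).
  have [le_kb|lt_bk] := leqP k b.
    apply: eq_reg (regB (regh k b) (rsum k b)) => g Og.
    by rewrite hE // LU_entry_upper ?addrK //; [apply: uL | apply: bR].
  by apply: (cst 0) => g Og; apply: borel_upper lt_bk; apply: bR.
split=> // a; have [lt_ka|le_ak] := ltnP k a.
  have rinv : reg (fun g => (R g k k)^-1).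
    by apply: regV => // g Og; apply: borel_diag; apply: bR.
  apply: eq_reg (regM (regB (regh a k) (rsum a k)) rinv) => g Og.
  rewrite hE // LU_entry_lower ?addrK //; [|exact: uL|exact: bR].
  by rewrite mulfK // borel_diag //; apply: bR.
apply: (cst (a == k)%:R) => g Og; case: eqVneq => [->|ak]; first by rewrite (uL Og).1.
by rewrite (uL Og).2 // -leqNgt.
Qed.

End RegLU.

End Regular.

(** * The big cell of [v] and its retraction onto a slice *)

Section BigCell.
Variables (C : numFieldType) (n : nat) (v : 'S_n).
Local Notation M := 'M[C]_n.

Lemma mul_pmatE (X : M) i j : (X *m pmat C v) i j = X i (v j).
Proof.
rewrite mxE (bigD1 (v j)) //= !mxE eqxx mulr1 big1 ?addr0 // => k kj.
by rewrite !mxE eq_sym (negPf kj) mulr0.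
Qed.

Lemma pmat_mulE (X : M) i j : (pmat C v *m X) i j = X (v^-1%g i) j.
Proof.
rewrite mxE (bigD1 (v^-1%g i)) //= !mxE permKV eqxx mul1r big1 ?addr0 // => k kj.
rewrite !mxE (_ : (v k == i) = false) ?mul0r //; apply: contraNF kj => /eqP<-.
by rewrite permK.
Qed.

Definition conjp (X : M) : M := \matrix_(i, j) X (v i) (v j).

Definition pull (X : M) : M := \matrix_(i, j) X (v i) j.

Lemma mul_pmat X : X *m pmat C v = pmat C v *m conjp X.
Proof. by apply/matrixP => i j; rewrite mul_pmatE pmat_mulE mxE permKV. Qed.

Lemma pullE X : pmat C v *m pull X = X.
Proof. by apply/matrixP => i j; rewrite pmat_mulE mxE permKV. Qed.

Lemma pull_pmat X : pull (pmat C v *m X) = X.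
Proof. by apply/matrixP => i j; rewrite mxE pmat_mulE permK. Qed.

Lemma pmat_unit : pmat C v \in unitmx.
Proof. by rewrite unitmx_tr unitmx_perm. Qed.

(** The positions off the diagonal in [v U_- v^-1], split into those above and those below the
    diagonal. The first are the inversions of [v], hence [ninv v] in number; the second parametrize
    the opposite cell. *)
Definition up : rel 'I_n := fun i j => (v^-1%g j < v^-1%g i)%N && (i < j)%N.
Definition dn : rel 'I_n := fun i j => (v^-1%g j < v^-1%g i)%N && ~~ (i < j)%N.
Local Notation gt := (fun i j : 'I_n => (v^-1%g j < v^-1%g i)%N).

Definition decomp (U A R g : M) :=
  [/\ unip up U, unip dn A, borel R & g = U *m A *m pmat C v *m R].

(* The open set [v B_- B] of [GL_n]. *)
Definition big_cell g := exists U A R, decomp U A R g.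

Lemma unip_gt_mul (U A : M) : unip up U -> unip dn A -> unip gt (U *m A).
Proof. by move=> uU uA; apply: unip_mul; [apply: gtS_sub uU | apply: gtN_sub uA]. Qed.

Lemma unip_conjp (X : M) : unip gt X -> unip (fun i j : 'I_n => (j < i)%N) (conjp X).
Proof.
case=> X1 X0; split=> [i|i j ij nlt]; rewrite mxE ?X1 // X0 ?permK //.
by rewrite (inj_eq perm_inj).
Qed.

Lemma conjp_unip (X : M) : unip (fun i j : 'I_n => (j < i)%N) X ->
  exists2 Y, unip gt Y & X = conjp Y.
Proof.
case=> X1 X0; exists (\matrix_(i, j) X (v^-1%g i) (v^-1%g j)).
  by split=> [i|i j ij nlt]; rewrite mxE ?X1 // X0 // (inj_eq perm_inj).
by apply/matrixP => i j; rewrite !mxE !permK.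
Qed.

Lemma conjp_inj (X Y : M) : conjp X = conjp Y -> X = Y.
Proof.
move=> XY; apply/matrixP => i j.
have := congr1 (fun Z : M => Z (v^-1%g i) (v^-1%g j)) XY.
by rewrite !mxE !permKV.
Qed.

Lemma decomp_pull U A R g : decomp U A R g -> pull g = conjp (U *m A) *m R.
Proof. by case=> _ _ _ ->; rewrite mul_pmat -mulmxA pull_pmat. Qed.

Lemma decomp_unique U A R U' A' R' g :
  decomp U A R g -> decomp U' A' R' g -> U = U' /\ A = A'.
Proof.
move=> dec dec'; have := decomp_pull dec; rewrite (decomp_pull dec').
case: dec dec' => uU uA bR _ [uU' uA' bR' _] eqLR.
have [/conjp_inj eqUA _] := LU_unique (unip_conjp (unip_gt_mul uU' uA')) bR'
  (unip_conjp (unip_gt_mul uU uA)) bR eqLR.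
by have [-> ->] := unip_factor_unique uU' uA' uU uA eqUA.
Qed.

(** The product of the leading principal minors of [v^-1 g], whose nonvanishing is the criterion for
    an LU factorization. *)
Definition cell_eqn g := \prod_(k < n.+1) \det (leading k (pull g)).

Lemma polmx_pull : polmx pull.
Proof. by apply: polmx_matrix => i j; apply: PolEntry. Qed.

Lemma pol_cell_eqn : pol cell_eqn.
Proof.
apply: pol_prod => k _; apply: pol_det; apply: polmx_matrix => i j.
by case: (i < k)%N; [apply: polmx_pull | apply: PolConst].
Qed.

Lemma big_cellP g : big_cell g <-> cell_eqn g != 0.
Proof.
split=> [[U [A [R dec]]]|/prodf_neq0 minors].
  apply/prodf_neq0 => k _; rewrite (decomp_pull dec).
  by case: dec => uU uA bR _; apply: LU_minors => //; apply/unip_conjp/unip_gt_mul.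
have [|L [R [uL bR gE]]] := @LU_exists _ _ (pull g).
  move=> k le_kn; have lt_k : (k < n.+1)%N by [].
  exact: (minors (Ordinal lt_k)).
have [X uX LE] := conjp_unip uL.
have [U [A [uU uA XE]]] := unip_factor (fun i j : 'I_n => (i < j)%N) uX.
exists U, A, R; split=> //.
by rewrite -XE mul_pmat -LE -mulmxA -gE pullE.
Qed.

Lemma big_cell_GL g : big_cell g -> g \in unitmx.
Proof.
case=> U [A [R [uU uA [uR _] ->]]].
rewrite unitmx_mul uR andbT mul_pmat unitmx_mul pmat_unit.
by have [] := unip_lower (unip_conjp (unip_gt_mul uU uA)).
Qed.

(** A choice, with identity matrices off the big cell; on it [decomp_unique] makes [decU] and [decA]
    independent of the choice. *)
Definition dec g : M * M * M :=
  xget (1%:M, 1%:M, 1%:M) [set t | decomp t.1.1 t.1.2 t.2 g]%classic.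
Definition decU g := (dec g).1.1.
Definition decA g := (dec g).1.2.
Definition decR g := (dec g).2.
(** The retraction onto the slice. The factors [U] and [R] that it drops are both in the Borel
    subgroup, so it respects Schubert varieties ([slice_rep_schubert]). *)
Definition slice_rep g := decA g *m pmat C v.

Lemma dec_decomp g : big_cell g -> decomp (decU g) (decA g) (decR g) g.
Proof.
case=> U [A [R decg]].
apply: (@xgetPex _ (1%:M, 1%:M, 1%:M)
  [set t : M * M * M | decomp t.1.1 t.1.2 t.2 g]%classic).
by exists (U, A, R).
Qed.

Lemma dec_eq U A R g : decomp U A R g -> decU g = U /\ decA g = A.
Proof.
by move=> decg; apply: (decomp_unique (dec_decomp _) decg); exists U, A, R.
Qed.

Lemma decomp_borel U A R g b : decomp U A R g -> borel b -> decomp U A (R *m b) (g *m b).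
Proof. by case=> uU uA bR -> bb; split=> //; [apply: borelM | rewrite !mulmxA]. Qed.

Lemma big_cell_borel g b : borel b -> big_cell (g *m b) <-> big_cell g.
Proof.
move=> bb; split=> [[U [A [R decg]]]|[U [A [R decg]]]]; exists U, A; last first.
  by exists (R *m b); apply: decomp_borel.
exists (R *m invmx b); have := decomp_borel decg (borelV bb).
by rewrite mulmxK //; case: bb.
Qed.

Lemma dec_borel g b : big_cell g -> borel b ->
  decU (g *m b) = decU g /\ slice_rep (g *m b) = slice_rep g.
Proof.
move=> /dec_decomp decg bb; have [-> ] := dec_eq (decomp_borel decg bb).
by rewrite /slice_rep => ->.
Qed.

Lemma reg_dec i j : reg big_cell (fun g => decU g i j) /\ reg big_cell (fun g => decA g i j).
Proof.
apply: (@reg_factor _ _ big_cell (fun i => v^-1%g i : nat) (fun i j => (i < j)%N)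
  (fun g => decU g *m decA g)) => // [g /dec_decomp[]|g /dec_decomp[]|k l] //.
pose L g := conjp (decU g *m decA g).
have regL a b : reg big_cell (fun g => L g a b).
  apply: (@reg_LU _ _ big_cell pull L decR) => [g /dec_decomp[uU uA _ _]|g /dec_decomp[]|g /dec_decomp dg|] //.
  - exact/unip_conjp/unip_gt_mul.
  - exact: decomp_pull dg.
  - by move=> c d; apply: pol_reg; apply: polmx_pull.
apply: eq_reg (regL (v^-1%g k) (v^-1%g l)) => g _.
by rewrite mxE !permKV.
Qed.

Lemma reg_slice_rep i j : reg big_cell (fun g => slice_rep g i j).
Proof.
by apply: eq_reg (reg_dec i (v j)).2 => g _; rewrite /slice_rep mul_pmatE.
Qed.

Definition slice (g : M) := exists2 A, unip dn A & g = A *m pmat C v.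

Lemma slice_decomp (U A : M) : unip up U -> unip dn A -> decomp U A 1%:M (U *m (A *m pmat C v)).
Proof. by move=> uU uA; split=> //; [apply: borel1 | rewrite mulmx1 mulmxA]. Qed.

Lemma slice_rep_mul (U g : M) : unip up U -> slice g ->
  [/\ big_cell (U *m g), decU (U *m g) = U & slice_rep (U *m g) = g].
Proof.
move=> uU [A uA ->]; have decg := slice_decomp uU uA.
have [UE AE] := dec_eq decg; rewrite /slice_rep AE UE; split=> //.
by exists U, A, 1%:M.
Qed.

Lemma slice_rep_id g : slice g -> big_cell g /\ slice_rep g = g.
Proof. by move=> /(slice_rep_mul (unip1 _ _))[]; rewrite mul1mx. Qed.

Lemma slice_repP g : big_cell g -> slice (slice_rep g).
Proof. by case/dec_decomp => _ uA _ _; exists (decA g). Qed.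

End BigCell.

Local Open Scope classical_set_scope.
Local Open Scope ring_scope.

(** * Schubert and Kazhdan-Lusztig varieties *)

Section Flags.
Variables (C : numFieldType) (n : nat).
Local Notation M := 'M[C]_n.
Implicit Types (g b : M) (u v w : 'S_n) (F : set (set M)).

Lemma flag_mulr g b : borel b -> flag (g *m b) = flag g.
Proof.
move=> bb; apply/seteqP; split=> _ [c bc <-].
  by exists (b *m c); rewrite ?mulmxA //; apply: borelM.
exists (invmx b *m c); first by apply: borelM bc; apply: borelV.
by rewrite mulmxA mulmxK //; case: bb.
Qed.

Lemma flag_eq g g' : flag g = flag g' -> exists2 b, borel b & g' = g *m b.
Proof.
move=> eq_flag; have : flag g' g' by exists 1%:M; [apply: borel1 | rewrite mulmx1].
by rewrite -eq_flag => -[b bb <-]; exists b.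
Qed.

Lemma flag_in g : g \in unitmx -> flag_variety (flag g).
Proof. by move=> ug; exists g. Qed.

Lemma closed_pol F : zariski_closed F -> exists S : set (M -> C),
  (forall p, S p -> pol p) /\
  forall g, g \in unitmx -> F (flag g) <-> forall p, S p -> p g = 0.
Proof.
case=> _ [S SE]; exists [set (fun g => mpoly.meval (mxvec g 0) p) | p in S].
split=> [_ [p _ <-]|g ug]; first exact: meval_pol.
have SE' : (GL g /\ F (flag g)) <->
    (GL g /\ forall p, S p -> mpoly.meval (mxvec g 0) p = 0).
  by have /= := congr1 (fun Z : set M => Z g) SE => ->.
split=> [Fg _ [p Sp <-]|Z0]; first by have [_] := SE'.1 (conj ug Fg); apply.
by have [] := SE'.2 (conj ug (fun p Sp => Z0 _ (ex_intro2 _ _ p Sp erefl))).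
Qed.

Lemma pol_closed (Z : M -> Prop) (S : set (M -> C)) :
  (forall p, S p -> pol p) ->
  (forall g, g \in unitmx -> Z g <-> forall p, S p -> p g = 0) ->
  (forall g b, g \in unitmx -> borel b -> Z g -> Z (g *m b)) ->
  zariski_closed [set flag g | g in [set g | g \in unitmx /\ Z g]].
Proof.
move=> polS ZS Zb; split=> [_ [g [ug _] <-]|]; first exact: flag_in.
exists [set p | S (fun g => mpoly.meval (mxvec g 0) p)].
apply/seteqP; split=> g [ug].
  move=> [g' [ug' Zg'] /flag_eq[b bb gE]]; split=> // p Sp.
  by apply: ((ZS g ug).1 _ _ Sp); rewrite gE; apply: Zb.
move=> S0; split=> //; exists g => //; split=> //; apply/(ZS g ug) => p Sp.
have [q pE] := pol_meval (polS p Sp); rewrite pE; apply: S0.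
by rewrite /= -(funext pE).
Qed.

Lemma pol_closedE (Z : M -> Prop) g :
  (forall g b, g \in unitmx -> borel b -> Z g -> Z (g *m b)) ->
  g \in unitmx -> [set flag g | g in [set g | g \in unitmx /\ Z g]] (flag g) <-> Z g.
Proof.
move=> Zb ug; split=> [[g' [ug' Zg'] /flag_eq[b bb ->]]|Zg]; first exact: Zb.
by exists g.
Qed.

Section CellZero.
Variables (v : 'S_n) (f : M -> C).
Hypothesis reg_f : reg (big_cell v) f.
Hypothesis inv_f : forall g b, big_cell v g -> borel b -> f (g *m b) = f g.

(** Adding the complement of the big cell makes the zero set of [f] closed in the whole flag
    variety: its equation is [cell_eqn v] times a numerator of [f]. *)
Definition cell_zero := [set flag g | g in
  [set g : M | g \in unitmx /\ (big_cell v g -> f g = 0)]].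

Let invZ g b : g \in unitmx -> borel b -> (big_cell v g -> f g = 0) ->
  big_cell v (g *m b) -> f (g *m b) = 0.
Proof. by move=> _ bb f0 /(big_cell_borel v g bb) og; rewrite inv_f ?f0. Qed.

Lemma cell_zero_closed : zariski_closed cell_zero.
Proof.
have [P [Q [polP _ fE]]] := reg_f.
apply: (pol_closed (S := [set (fun g => cell_eqn v g * P g)])) => [_ ->|g ug|].
- by apply: PolMul => //; apply: pol_cell_eqn.
- split=> [f0 _ ->|/(_ _ erefl) /eqP].
    have [/big_cellP/[dup] og /f0|/negbNE/eqP->] := boolP (cell_eqn v g != 0).
      have [Q0 ->] := fE g og; move/eqP.
      by rewrite mulf_eq0 invr_eq0 (negPf Q0) orbF => /eqP->; rewrite mulr0.
    by rewrite mul0r.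
  rewrite mulf_eq0 => /orP[/eqP e0 /big_cellP|/eqP P0 og]; first by rewrite e0 eqxx.
  by have [_ ->] := fE g og; rewrite P0 mul0r.
- by move=> g b ug bb f0; apply: invZ.
Qed.

Lemma cell_zeroE g : g \in unitmx -> cell_zero (flag g) <-> (big_cell v g -> f g = 0).
Proof.
by move=> ug; apply: (pol_closedE (Z := fun g => big_cell v g -> f g = 0)).
Qed.

End CellZero.

(** As equations serve all polynomials vanishing on the variety; they include those of every closed
    set containing the cell. *)
Lemma schubert_closed w : zariski_closed (@schubert_variety C n w).
Proof.
split=> [x Xx|].
  apply: Xx; split; last first.
    by move=> _ [b [ub _] <-]; apply: flag_in; rewrite unitmx_mul ub pmat_unit.
  split=> //; exists set0; apply/seteqP; split=> g [ug _]; split=> //.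
  exact: flag_in.
exists [set p | forall g, g \in unitmx -> schubert_variety w (flag g) ->
  mpoly.meval (mxvec g 0) p = 0].
apply/seteqP; split=> g [ug].
  by move=> Xg; split=> // p; apply.
move=> p0; split=> // F [closedF cellF].
have [_ [S SE]] := closedF.
suff : [set g | GL g /\ F (flag g)] g by case.
rewrite SE; split=> // p Sp; apply: p0 => g' ug' Xg'.
have : [set g | GL g /\ F (flag g)] g' by split=> //; apply: Xg'.
by rewrite SE => -[_]; apply.
Qed.

Lemma schubert_min w F : zariski_closed F -> schubert_cell w `<=` F ->
  schubert_variety w `<=` F.
Proof. by move=> closedF cellF x; apply. Qed.

Lemma cell_schubert w : schubert_cell w `<=` @schubert_variety C n w.
Proof. by move=> x cx F [_]; apply. Qed.

(** The condition that [b g] lies in the variety is closed in [g] and holds on the cell. *)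
Lemma borel_schubert w b g : borel b -> g \in unitmx ->
  schubert_variety w (flag g) -> schubert_variety w (flag (b *m g)).
Proof.
move=> bb ug Xg; have ub : b \in unitmx by case: bb.
pose Z g := schubert_variety w (flag (b *m g)).
have Zb h c : h \in unitmx -> borel c -> Z h -> Z (h *m c).
  by move=> _ bc; rewrite /Z mulmxA (flag_mulr _ bc).
apply: (pol_closedE Zb ug).1; apply: schubert_min Xg.
  have [S [polS SE]] := closed_pol (schubert_closed w).
  apply: (pol_closed (S := [set (fun g => p (b *m g)) | p in S])) => //.
    move=> _ [p Sp <-]; apply: (pol_comp (h := fun g => b *m g)) (polS p Sp).
    by apply: polmx_mul; [apply: polmx_const | apply: polmx_id].
  move=> h uh; rewrite /Z SE ?unitmx_mul ?ub //.
  by split=> [p0 _ [p Sp <-]|p0 p Sp]; [apply: p0 | apply: (p0 (fun g => p (b *m g))); exists p].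
move=> _ [c bc <-]; exists (c *m pmat C w) => //; split.
  by rewrite unitmx_mul pmat_unit andbT; case: bc.
apply: cell_schubert; exists (b *m c); last by rewrite mulmxA.
exact: borelM.
Qed.

Lemma conjp_upper w (D : M) : unip (fun i j => ~~ (w^-1%g j < w^-1%g i)%N) D ->
  borel (conjp w D).
Proof.
case=> D1 D0; apply: unip_upper; split=> [i|i j ij nlt]; rewrite mxE ?D1 // D0 //.
  by rewrite (inj_eq perm_inj).
by rewrite !permK negbK ltn_neqAle leqNgt nlt andbT eq_sym; exact: ij.
Qed.

(** Once the diagonal is normalized, the factor [D] and the diagonal become upper triangular when
    moved past [w], and disappear in [G/B]. With [rho i = n - i] this treats upper triangular [b],
    with [rho i = i] lower triangular [b]. *)
Lemma flag_unip (rho : 'I_n -> nat) w b : (forall i, b i i != 0) ->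
  (forall i j, i != j -> (rho i <= rho j)%N -> b i j = 0) ->
  exists2 A, unip (fun i j => (rho j < rho i)%N && (w^-1%g j < w^-1%g i)%N) A &
    flag (b *m pmat C w) = flag (A *m pmat C w).
Proof.
move=> b_diag b0; pose d : 'rV[C]_n := \row_i b i i.
pose X : M := \matrix_(i, j) (b i j / b j j).
have bE : b = X *m diag_mx d.
  by apply/matrixP => i j; rewrite mul_mx_diag !mxE divfK.
have uX : unip (fun i j : 'I_n => (rho j < rho i)%N) X.
  by split=> [i|i j ij nlt]; rewrite mxE ?divff // b0 ?mul0r // leqNgt.
have [A [D [uA uD XE]]] :=
  unip_factor (fun i j : 'I_n => (w^-1%g j < w^-1%g i)%N) uX.
exists A => //.
have bD : borel (conjp w D) by apply/conjp_upper/(unip_sub _ uD) => i j /andP[].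
have bd : borel (conjp w (diag_mx d)).
  split; last first.
    apply/is_trig_mxP => i j ij; rewrite !mxE (inj_eq perm_inj).
    by rewrite (_ : (j == i) = false) ?mulr0n // -val_eqE /= gtn_eqF.
  have : pmat C w *m conjp w (diag_mx d) \in unitmx.
    rewrite -mul_pmat unitmx_mul pmat_unit andbT unitmxE det_diag unitfE.
    by apply/prodf_neq0 => i _; rewrite mxE.
  by rewrite unitmx_mul => /andP[].
have -> : b *m pmat C w = A *m pmat C w *m (conjp w D *m conjp w (diag_mx d)).
  rewrite bE XE -!mulmxA mul_pmat; congr (_ *m _).
  by rewrite [LHS]mulmxA mul_pmat mulmxA.
by rewrite flag_mulr //; apply: borelM.
Qed.

(** * Affine coordinates on Schubert cells *)

Section CellParam.
Variable w : 'S_n.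

(** Only the entries at inversions of [w] are read: the whole matrix space maps polynomially to the
    cell, and the results on [pol] apply to it. *)
Definition cell_mx (m : M) : M :=
  \matrix_(i, j) if i == j then 1 else if up w i j then m i j else 0.
Definition cell_point m := cell_mx m *m pmat C w.

Lemma cell_mx_unip m : unip (up w) (cell_mx m).
Proof.
split=> [i|i j ij nup]; rewrite mxE ?eqxx //.
by rewrite (negPf ij) (negPf nup).
Qed.

Lemma cell_mx_borel m : borel (cell_mx m).
Proof. by apply/unip_upper/(unip_sub _ (cell_mx_unip m)) => i j /andP[]. Qed.

Lemma cell_point_unit m : cell_point m \in unitmx.
Proof. by rewrite unitmx_mul pmat_unit andbT; case: (cell_mx_borel m). Qed.

Lemma cell_point_cell m : schubert_cell w (flag (cell_point m)).
Proof. by exists (cell_mx m) => //; apply: cell_mx_borel. Qed.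

Lemma polmx_cell_point : polmx cell_point.
Proof.
apply: polmx_mul; last exact: polmx_const.
apply: polmx_matrix => i j; case: (i == j); first exact: PolConst.
by case: (up w i j); [apply: PolEntry | apply: PolConst].
Qed.

Lemma cell_param x : schubert_cell w x -> exists2 m : M,
  (forall i j, ~~ up w i j -> m i j = 0) & x = flag (cell_point m).
Proof.
case=> b bb <-.
have lt_sub (i j : 'I_n) : (n - j < n - i)%N = (i < j)%N.
  by move: (ltn_ord j) (ltn_ord i); lia.
have [i|i j ij|A uA ->] := @flag_unip (fun i => n - i)%N w b; first exact: borel_diag.
  rewrite leqNgt lt_sub -leqNgt => le_ji; apply: borel_upper => //.
  by rewrite ltn_neqAle le_ji andbT eq_sym; exact: ij.
exists (\matrix_(i, j) if up w i j then A i j else 0).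
  by move=> i j /negPf nup; rewrite mxE nup.
congr (flag (_ *m _)); apply/matrixP => i j; rewrite !mxE.
case: eqVneq => [->|ij]; first exact: uA.1.
have [//|nup] := boolP (up w i j).
by apply: uA.2; rewrite // lt_sub andbC.
Qed.

(** An equation of [F] that is nonzero somewhere on the cell would be nonzero at a point where [G]
    is nonzero too. *)
Lemma schubert_dense F (G : M -> C) m0 : zariski_closed F -> pol G ->
  G (cell_point m0) != 0 ->
  (forall m, G (cell_point m) != 0 -> F (flag (cell_point m))) ->
  schubert_variety w `<=` F.
Proof.
move=> closedF polG G0 FG; apply: schubert_min => // _ /cell_param[m _ ->].
have [S [polS SE]] := closed_pol closedF.
apply/SE => [|p Sp]; first exact: cell_point_unit.
apply/eqP/negPn/negP => pm.
have [k [pk Gk]] := pol_neq0_mul (pol_comp polmx_cell_point (polS p Sp))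
  (pol_comp polmx_cell_point polG) pm G0.
have := FG k Gk; move/(SE _ (cell_point_unit k))/(_ p Sp) => p0.
by move: pk; rewrite /= p0 eqxx.
Qed.

End CellParam.

Definition elem_mx (a b : 'I_n) (s : C) : M := 1%:M + s *: delta_mx a b.

Lemma elem_mx_borel (a b : 'I_n) s : (a < b)%N -> borel (elem_mx a b s).
Proof.
move=> ab; apply: unip_upper; split=> [i|i j ij nlt]; rewrite !mxE ?eqxx.
  have [->|] := eqVneq i a; last by rewrite andFb mulr0 addr0.
  by rewrite -[a == b]val_eqE /= ltn_eqF // mulr0 addr0.
rewrite (negPf ij) add0r; case: andP => [[/eqP ia /eqP jb]|]; last by rewrite mulr0.
by rewrite ia jb ab in nlt.
Qed.

Lemma conjp_elem_mx u (a b : 'I_n) s : conjp u (elem_mx a b s) = elem_mx (u^-1%g a) (u^-1%g b) s.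
Proof.
apply/matrixP => i j; rewrite !mxE (inj_eq perm_inj).
by rewrite -(inj_eq (@perm_inj _ u^-1%g) (u i)) -(inj_eq (@perm_inj _ u^-1%g) (u j)) !permK.
Qed.

Lemma pmatM u t : pmat C (u * t)%g = pmat C t *m pmat C u.
Proof. by apply/matrixP => i j; rewrite mul_pmatE !mxE permM. Qed.

(* The SL_2 identity [[1,0],[r,1]] = [[-1/r,1],[0,r]] [[0,1],[1,0]] [[1,1/r],[0,1]]. *)
Lemma elem_mx_lower (a b : 'I_n) r : (a < b)%N -> r != 0 -> exists2 B, borel B &
  elem_mx b a r = B *m pmat C (tperm a b) *m elem_mx a b r^-1.
Proof.
move=> ab r0; have nab : a != b by rewrite -val_eqE /= ltn_eqF.
have /negPf fab := nab; have fba : (b == a) = false by rewrite eq_sym.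
pose B : M := \matrix_(i, j) ((if i == j then (if i == a then - r^-1 else if i == b then r else 1) else 0) + ((i == a) && (j == b))%:R).
have bB : borel B.
  have tB : is_trig_mx B^T.
    apply/is_trig_mxP => i j ij; rewrite !mxE -val_eqE /= gtn_eqF // add0r.
    by case: andP => // -[/eqP ja /eqP ib]; move: ij; rewrite ja ib ltnNge ltnW.
  split=> //; rewrite -unitmx_tr unitmxE det_trig // unitfE; apply/prodf_neq0 => i _.
  rewrite !mxE eqxx; have [->|ia] := eqVneq i a.
    by rewrite fab addr0 oppr_eq0 invr_eq0.
  by rewrite addr0; case: ifP => //; rewrite oner_eq0.
exists B => //.
have -> : B *m pmat C (tperm a b) = elem_mx b a r *m elem_mx a b (- r^-1).
  apply/matrixP => i j; rewrite mul_pmatE.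
  rewrite /elem_mx mulmxDl mul1mx mulmxDr mulmx1 -scalemxAl -scalemxAr mul_delta_mx scalerA.
  rewrite mulrN divff // scaleN1r !mxE.
  have [->|ja] := eqVneq j a; last first.
    have [->|jb] := eqVneq j b; last first.
      rewrite tpermD 1?eq_sym // (negPf jb) !andbF.
      by have [->|ij] := eqVneq i j; rewrite ?(negPf ja) ?(negPf jb) /=; ring.
    rewrite tpermR fab !andbF !andbT.
    have [->|ia] := eqVneq i a; first by rewrite fab /=; ring.
    by rewrite /=; ring.
  rewrite tpermL eqxx fab !andbF !andbT.
  have [->|ib] := eqVneq i b; first by rewrite fba /=; ring.
  by rewrite /=; ring.
rewrite -mulmxA (_ : elem_mx a b (- r^-1) *m elem_mx a b r^-1 = 1%:M) ?mulmx1 //.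
rewrite /elem_mx mulmxDl mul1mx mulmxDr mulmx1 -scalemxAl -scalemxAr mul_delta_mx_0 //; last by rewrite eq_sym.
by rewrite !scaler0 addr0 scaleNr addrK.
Qed.

(** The curve [elem_mx b a r] times [u] passes through [u] at [r = 0] and, by the SL_2 identity,
    lies in the larger cell for [r != 0]. The equations of the closure extend to [r = 0]. *)
Lemma schubert_step u w : bruhat_step u w -> @schubert_variety C n w (flag (pmat C u)).
Proof.
case/bruhat_stepP => a [b [ab pab ->]]; set w' := (u * _)%g.
have [S [polS SE]] := closed_pol (schubert_closed w').
apply/SE => [|p Sp]; first exact: pmat_unit.
apply: (pol_line_eq0 (b := delta_mx b a *m pmat C u) (polS p Sp)) => r r0.
have -> : pmat C u + r *: (delta_mx b a *m pmat C u) = elem_mx b a r *m pmat C u.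
  by rewrite mulmxDl mul1mx scalemxAl.
have [B bB ->] := elem_mx_lower ab r0.
rewrite -!mulmxA mul_pmat conjp_elem_mx (mulmxA (pmat C _)) -pmatM mulmxA -/w'.
have bE : borel (elem_mx (u^-1%g a) (u^-1%g b) r^-1) by apply: elem_mx_borel.
apply: ((SE _ _).1 _ _ Sp).
  by rewrite !unitmx_mul pmat_unit; case: bB => ->; case: bE => ->.
by rewrite flag_mulr //; apply: cell_schubert; exists B.
Qed.

Lemma schubert_le u w : bruhat_le u w ->
  @schubert_variety C n u `<=` schubert_variety w.
Proof.
move: w; apply: bruhat_le_ind => [//|y w _ IH yw].
apply: subset_trans IH _; apply: schubert_min; first exact: schubert_closed.
move=> _ [b bb <-]; apply: borel_schubert => //; first exact: pmat_unit.
exact: schubert_step.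
Qed.

Lemma schubert_pmat w : @schubert_variety C n w (flag (pmat C w)).
Proof. by apply: cell_schubert; exists 1%:M; [apply: borel1 | rewrite mul1mx]. Qed.

End Flags.

Section Combinations.
Variables (C : numFieldType) (n : nat).
Local Notation M := 'M[C]_n.
Variable O : M -> Prop.
Implicit Types (Fs : seq (M -> C)).

Lemma reg_eval_coefs D c Fs : List.Forall (reg O) Fs -> reg O (fun g => eval_coefs D c (values Fs g)).
Proof.
move=> rFs; apply: (@eq_reg _ _ O (fun g => \sum_(e <- exponents D (size Fs)) c e * monomial (values Fs g) e)).
  by move=> g _; rewrite /eval_coefs size_map.
apply: reg_sum => e _; apply: regM; first by apply/pol_reg/PolConst.
elim: rFs e => [|F Fs' rF _ IH] [|k e]; try by apply/pol_reg/PolConst.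
apply: regM; last exact: IH.
elim: k => [|k IHk]; first by apply/pol_reg/PolConst.
apply: (@eq_reg _ _ O (fun g => F g * F g ^+ k)); first by move=> g _; rewrite exprS.
exact: regM.
Qed.

Lemma pol_eval_coefs D c Fs : List.Forall (@pol C n) Fs -> pol (fun g => eval_coefs D c (values Fs g)).
Proof.
move=> pFs; apply: (@eq_pol _ _ (fun g => \sum_(e <- exponents D (size Fs)) c e * monomial (values Fs g) e)).
  by move=> g; rewrite /eval_coefs size_map.
apply: pol_sum => e _; apply: PolMul; first exact: PolConst.
elim: pFs e => [|F Fs' pF _ IH] [|k e]; try exact: PolConst.
by apply: PolMul; [apply: pol_exp | apply: IH].
Qed.

Lemma reg_common_denom Fs : List.Forall (reg O) Fs -> exists Q Ps,
  [/\ pol Q, List.Forall (@pol C n) Ps, size Ps = size Fs &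
    forall g, O g -> Q g != 0 /\ values Fs g = [seq v / Q g | v <- values Ps g]].
Proof.
elim=> [|F Fs' [P [Q' [pP pQ' FE]]] _ [Q [Ps [pQ pPs sz FsE]]]].
  exists (fun=> 1), [::]; split=> //.
  exact: PolConst.
exists (fun g => Q g * Q' g), ((fun g => P g * Q g) :: [seq (fun g => p g * Q' g) | p <- Ps]).
split; first exact: PolMul.
- constructor; first exact: PolMul.
  by elim: pPs => [|p ps pp _ IH] /=; constructor => //; apply: PolMul.
- by rewrite /= size_map sz.
move=> g Og; have [Q0 E] := FsE g Og; have [Q'0 EF] := FE g Og.
rewrite mulf_neq0 //; split=> //=; rewrite EF E; congr (_ :: _); last first.
  rewrite /values -!map_comp; apply: eq_map => p /=.
  by field; rewrite Q'0 Q0.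
by field; rewrite Q0 Q'0.
Qed.

End Combinations.

Lemma Forall_map (T U : Type) (P : T -> Prop) (Q : U -> Prop) (f : T -> U) (s : seq T) :
  (forall x, P x -> Q (f x)) -> List.Forall P s -> List.Forall Q [seq f x | x <- s].
Proof. by move=> PQ; elim=> [|x s' Px _ IH] /=; constructor => //; apply: PQ. Qed.

(** * Irreducibility and dimension of Kazhdan-Lusztig varieties *)

Section KazhdanLusztig.
Variables (C : numFieldType) (n : nat).
Local Notation M := 'M[C]_n.
Implicit Types (u v w : 'S_n) (F : set (set M)).
Local Notation X w := (@schubert_variety C n w).
Local Notation N v w := (@kazhdan_lusztig C n v w).

Lemma slice_unit v (g : M) : slice v g -> g \in unitmx.
Proof. by move=> /slice_rep_id[/big_cell_GL]. Qed.

Lemma opposite_slice v x : @opposite_cell C n v x -> exists2 g, slice v g & x = flag g.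
Proof.
case=> b [ub tb] <-.
have [i|i j ij le_ij|A uA ->] := @flag_unip C n (fun i => i : nat) v b.
- exact: trig_unit_diag.
- by apply: (is_trig_mxP tb); rewrite ltn_neqAle le_ij andbT; exact: ij.
exists (A *m pmat C v) => //; exists A => //.
by apply: unip_sub uA => i j /andP[lt_ji pij]; rewrite /dn pij -leqNgt ltnW.
Qed.

Lemma slice_opposite v (g : M) : slice v g -> opposite_cell v (flag g).
Proof.
case=> A uA ->; exists A => //; apply: unip_lower.
case: uA => A1 A0; split=> // i j ij nlt; apply: A0 => //.
by rewrite /dn negb_and negbK; apply/orP; right; rewrite ltn_neqAle leqNgt nlt andbT.
Qed.

Lemma kl_slice v w x : N v w x -> exists g, [/\ slice v g, X w (flag g) & x = flag g].
Proof. by case=> Xx /opposite_slice[g sg xE]; exists g; rewrite -xE. Qed.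

Lemma slice_kl v w (g : M) : slice v g -> X w (flag g) -> N v w (flag g).
Proof. by move=> sg Xg; split=> //; apply: slice_opposite. Qed.

Lemma reg_pol_slice_rep v (p : M -> C) : pol p -> reg (big_cell v) (p \o slice_rep v).
Proof. by move=> pp; apply: reg_comp => // i j; apply: reg_slice_rep. Qed.

Lemma slice_rep_schubert v w (g : M) : big_cell v g ->
  X w (flag g) <-> X w (flag (slice_rep v g)).
Proof.
move=> og; have sg := slice_repP og; have us := slice_unit sg; have ug := big_cell_GL og.
have [uU uA bR gE] := dec_decomp og.
have bU : borel (decU v g) by apply/unip_upper/(unip_sub _ uU) => i j /andP[].
have flagE : flag g = flag (decU v g *m slice_rep v g).
  by rewrite {1}gE flag_mulr // /slice_rep mulmxA.
split=> [|Xs]; last by rewrite flagE; apply: borel_schubert.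
rewrite flagE => Xs; have [uU' _] := bU; rewrite -[slice_rep v g](mulKmx uU').
apply: borel_schubert => //; first exact: borelV.
by rewrite unitmx_mul us uU'.
Qed.

(* Pulling back along the retraction turns a polynomial function on the slice into a closed condition on [G/B]. *)
Definition slice_zero v (p : M -> C) := cell_zero v (p \o slice_rep v).

Lemma slice_zero_closed v p : pol p -> zariski_closed (slice_zero v p).
Proof.
move=> pp; apply: cell_zero_closed; first exact: reg_pol_slice_rep.
by move=> g b og bb; rewrite /= (dec_borel og bb).2.
Qed.

Lemma slice_zeroE v p (g : M) : slice v g -> slice_zero v p (flag g) <-> p g = 0.
Proof.
move=> sg; have [og gE] := slice_rep_id sg.
have ug := slice_unit sg.
split=> [/(cell_zeroE _ ug)|p0].
  by move=> h; rewrite -gE; apply: h => // h' b oh bb /=; rewrite (dec_borel oh bb).2.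
apply/cell_zeroE => //; first by move=> h b oh bb /=; rewrite (dec_borel oh bb).2.
by move=> _ /=; rewrite gE.
Qed.

(** Otherwise [fs], pulled back along the retraction, and the [ninv v] entries of [decU] are too
    many functions of the coordinates of the Schubert cell. A relation on the cell spreads to [X w],
    its zero set being closed, and contradicts independence there. *)
Lemma indep_bound v w (fs : seq (M -> C)) : List.Forall (@pol C n) fs ->
  alg_indep (fun g => slice v g /\ X w (flag g)) fs -> (size fs + ninv v <= ninv w)%N.
Proof.
move=> pfs indep; rewrite leqNgt; apply/negP => lt_w.
pose r := enum (inversions v).
pose ys : seq (M -> C) := [seq (fun g => decU v g p.1 p.2) | p <- r].
pose fs' := [seq f \o slice_rep v | f <- fs].
have mem_r i j : ((i, j) \in r) = up v i j by rewrite mem_enum inE /up andbC.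
have {}indep : alg_indep (fun g => big_cell v g /\ X w (flag g)) (ys ++ fs').
  apply: alg_indep_free indep => [y t [sy Xy]|]; last by rewrite size_map.
  rewrite size_map => sz_t.
  (* The point of the fibre over [y] whose coordinates are the prescribed values [t]. *)
  pose U : M := \matrix_(i, j) if i == j then 1 else
    if up v i j then nth 0 t (index (i, j) r) else 0.
  have uU : unip (up v) U.
    split=> [i|i j ij nup]; rewrite mxE ?eqxx //.
    by rewrite (negPf ij) (negPf nup).
  have [oUy UE yE] := slice_rep_mul uU sy.
  exists (U *m y); split.
  - split=> //; apply: borel_schubert => //; last exact: slice_unit sy.
    by apply/unip_upper/(unip_sub _ uU) => i j /andP[].
  - apply: (@eq_from_nth _ 0) => [|k]; rewrite !size_map ?sz_t // => lt_k.
    rewrite (nth_map (fun=> 0)) ?size_map //.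
    have /hasP[p0 _ _] : has predT r by rewrite has_predT (leq_ltn_trans _ lt_k).
    rewrite (nth_map p0) // UE mxE; have := mem_nth p0 lt_k.
    case E : (nth p0 r k) => [i j] /=; rewrite mem_r => upij.
    rewrite upij (_ : (i == j) = false); last first.
      by apply: contraTF upij => /eqP->; rewrite /up ltnn.
    by rewrite -E index_uniq // enum_uniq.
  - rewrite /values -map_comp; apply: eq_map => f /=; by rewrite yE.
have rFs : List.Forall (reg (big_cell v)) (ys ++ fs').
  apply/List.Forall_app; split; last by apply: Forall_map pfs => f; apply: reg_pol_slice_rep.
  apply: (@Forall_map _ _ (fun=> True)) => [p _|]; first by case: (@reg_dec C n v p.1 p.2).
  by apply/List.Forall_forall.
have [Q [Ps [pQ pPs sz FsE]]] := reg_common_denom rFs.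
have pPs' : List.Forall (@pol C n) [seq P \o cell_point w | P <- Ps].
  by apply: Forall_map pPs => P; apply: pol_comp; apply: polmx_cell_point.
have lt_sz : (#|inversions w| < size [seq P \o cell_point w | P <- Ps])%N.
  by rewrite size_map sz size_cat !size_map -cardE addnC.
have [D [c [[e eB ce] dep]]] := alg_dependence lt_sz pPs'
  (pol_comp (@polmx_cell_point C n w) pQ).
pose f g := eval_coefs D c (values (ys ++ fs') g).
have inv_f g b : big_cell v g -> borel b -> f (g *m b) = f g.
  move=> og bb; have [UE sE] := dec_borel og bb; rewrite /f /values !map_cat.
  congr (eval_coefs _ _ (_ ++ _)); rewrite -!map_comp; apply: eq_map => p /=.
    by rewrite UE.
  by rewrite sE.
have closedZ := cell_zero_closed (reg_eval_coefs D c rFs) inv_f.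
have XZ : X w `<=` cell_zero v f.
  apply: schubert_min => // _ /cell_param[m supp ->].
  apply/cell_zeroE => //; first exact: cell_point_unit.
  move=> og; have [Q0 E] := FsE _ og; rewrite /f E.
  have := dep m; rewrite /values -map_comp; apply=> //.
  by move=> i j ij; apply: supp; apply: contra ij; rewrite inE /up /= andbC.
move/eqP: ce; apply; apply: (indep D c) => [g [og Xg]|].
  exact: (cell_zeroE inv_f (big_cell_GL og)).1 (XZ _ Xg) og.
suff -> : size (ys ++ fs') = size [seq P \o cell_point w | P <- Ps] by [].
by rewrite size_map sz.
Qed.

(** The empty family suffices: only the fibre coordinates are counted. *)
Lemma schubert_pmat_inv v w : X w (flag (pmat C v)) -> (ninv v <= ninv w)%N.
Proof.
move=> Xv; apply: (@indep_bound v w [::]); first exact: List.Forall_nil.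
apply: alg_indep_nil; exists (pmat C v); split=> //.
by exists 1%:M; [apply: unip1 | rewrite mul1mx].
Qed.

(** Primality of the vanishing ideal of [Z] on the slice, in the form that [alg_indep_cons] asks
    for. *)
Lemma irreducible_slice v (Z : set (set M)) (p q : M -> C) :
  irreducible_set (@zariski_closed C n) Z -> Z `<=` opposite_cell v ->
  pol p -> pol q ->
  (forall g, slice v g -> Z (flag g) -> p g * q g = 0) ->
  (forall g, slice v g -> Z (flag g) -> p g = 0) \/
  (forall g, slice v g -> Z (flag g) -> q g = 0).
Proof.
case=> _ irr ZO pp pq pq0.
have [x Zx|Zp|Zq] := irr _ _ (slice_zero_closed v pp) (slice_zero_closed v pq).
- have [g sg xE] := opposite_slice (ZO _ Zx).
  move: Zx; rewrite xE => Zg; have /eqP := pq0 g sg Zg.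
  by rewrite mulf_eq0 => /orP[] /eqP h0; [left | right]; apply/slice_zeroE.
- by left=> g sg /Zp/slice_zeroE; apply.
- by right=> g sg /Zq/slice_zeroE; apply.
Qed.

Lemma chain_bound v w d : has_chain (@zariski_closed C n) (N v w) d ->
  (d + ninv v <= ninv w)%N.
Proof.
case=> Z [Zirr Zlt].
have ZN i : (i <= d)%N -> Z i `<=` N v w.
  by move=> /Zirr[[F _ ->] _] x [].
suff main i : (i <= d)%N -> exists fs, [/\ size fs = i, List.Forall (@pol C n) fs &
    alg_indep (fun g => slice v g /\ Z i (flag g)) fs].
  have [fs [sz pfs indep]] := main d (leqnn d); rewrite -sz.
  apply: indep_bound pfs _ => D c c0; apply: indep => g [sg Zg].
  by apply: c0; split=> //; case: (ZN d (leqnn d) _ Zg).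
elim: i => [|i IHi] le_id.
  exists [::]; split=> //.
  have [_ [[x Zx] _]] := Zirr 0%N le_id.
  have [g [sg _ xE]] := kl_slice (ZN _ le_id _ Zx).
  by apply: alg_indep_nil; exists g; rewrite -xE.
have [fs [sz pfs indep]] := IHi (ltnW le_id).
have [subZ nsubZ] := Zlt i le_id.
have [[F closedF ZE] _] := Zirr i (ltnW le_id).
have [_ irr] := Zirr i.+1 le_id.
have [x Zx nZx] : exists2 x, Z i.+1 x & ~ Z i x.
  by apply: contrapT => no; apply: nsubZ => x Zx; apply: contrapT => nZx; apply: no; exists x.
have Nx := ZN _ le_id _ Zx; have [g [sg _ xE]] := kl_slice Nx.
have [S [polS SE]] := closed_pol closedF.
have [p Sp pg] : exists2 p, S p & p g <> 0.
  apply: contrapT => no; apply: nZx; rewrite ZE; split=> //.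
  rewrite xE; apply/SE; first exact: slice_unit sg.
  by move=> p Sp; apply: contrapT => pg; apply: no; exists p.
have pp := polS p Sp.
have ZO : Z i.+1 `<=` opposite_cell v by move=> y /(ZN _ le_id)[].
exists (p :: fs); split; [by rewrite /= sz | by constructor |].
apply: (alg_indep_cons (A := @pol C n)) indep => [h [sh Zh]|h [sh Zh]|m D c|m h ph h0].
- by split=> //; apply: subZ.
- by move: Zh; rewrite ZE => -[_ /SE]; apply=> //; apply: slice_unit sh.
- apply: pol_sum => k _; apply: PolMul; first exact: pol_exp.
  exact: pol_eval_coefs.
have [g' sg' Zg'|pm0|h0' g' [sg' Zg']] := irreducible_slice (Zirr _ le_id).2 ZO
  (pol_exp m pp) ph; [exact: h0| |exact: h0'].
case: pg; have := pm0 g sg; rewrite -xE => /(_ Zx)/eqP.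
by rewrite expf_eq0 => /andP[_ /eqP].
Qed.

(** A closed [F] missing a point of [N v w] yields a polynomial [G], nonzero somewhere on the
    Schubert cell, whose nonvanishing puts the retracted point outside [F]. For two such sets, a
    common nonzero point in the cell coordinates retracts to a point of [N v w] outside both. *)
Lemma kl_irreducible v w : bruhat_le v w -> irreducible_set (@zariski_closed C n) (N v w).
Proof.
move=> vw; have Xv : X w (flag (pmat C v)) by apply: (schubert_le vw); apply: schubert_pmat.
have sv : slice v (pmat C v) by exists 1%:M; [apply: unip1 | rewrite mul1mx].
split; first by exists (flag (pmat C v)); apply: slice_kl.
move=> F1 F2 closed1 closed2 N12.
have witness F : zariski_closed F -> ~ (N v w `<=` F) -> exists p, [/\ pol p,
    forall g, g \in unitmx -> F (flag g) -> p g = 0 & exists G, [/\ pol G,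
    forall g, G g != 0 -> big_cell v g /\ p (slice_rep v g) != 0 &
    exists m, G (cell_point w m) != 0]].
  move=> closedF NF; have [S [polS SE]] := closed_pol closedF.
  have [x Nx nFx] : exists2 x, N v w x & ~ F x.
    by apply: contrapT => no; apply: NF => x Nx; apply: contrapT => nFx; apply: no; exists x.
  have [g [sg Xg xE]] := kl_slice Nx; have ug := slice_unit sg.
  have [p Sp pg] : exists2 p, S p & p g <> 0.
    apply: contrapT => no; apply: nFx; rewrite xE; apply/SE => // p Sp.
    by apply: contrapT => pg; apply: no; exists p.
  have pp := polS p Sp; exists p; split=> //; first by move=> h uh /(SE h uh); apply.
  have [P [Q [pP pQ PQE]]] := reg_pol_slice_rep v pp.
  exists (fun g => cell_eqn v g * P g); split.
  - by apply: PolMul => //; apply: pol_cell_eqn.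
  - move=> h; rewrite mulf_eq0 negb_or => /andP[/big_cellP oh Ph]; split=> //.
    by have [Q0 /= ->] := PQE h oh; rewrite mulf_neq0 ?invr_eq0.
  (* If [G] vanished on the whole cell, [slice_zero v p] would contain the cell, hence [X w] and the
     point [g]. *)
  apply: contrapT => no; apply: pg; apply/(slice_zeroE p sg).
  apply: (schubert_min (slice_zero_closed v pp)) Xg => _ /cell_param[m _ ->].
  apply/cell_zeroE; first by move=> h b oh bb /=; rewrite (dec_borel oh bb).2.
    exact: cell_point_unit.
  move=> om; have [Q0 ->] := PQE _ om.
  have [->|Pm] := eqVneq (P (cell_point w m)) 0; first by rewrite mul0r.
  by case: no; exists m; rewrite mulf_neq0 //; apply/big_cellP.
have [|n1] := pselect (N v w `<=` F1); first by left.
have [|n2] := pselect (N v w `<=` F2); first by right.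
have [p1 [pp1 F1p [G1 [pG1 G1E [m1 G1m]]]]] := witness _ closed1 n1.
have [p2 [pp2 F2p [G2 [pG2 G2E [m2 G2m]]]]] := witness _ closed2 n2.
have [m [/G1E[om p1m] /G2E[_ p2m]]] := pol_neq0_mul (pol_comp (@polmx_cell_point C n w) pG1)
  (pol_comp (@polmx_cell_point C n w) pG2) G1m G2m.
have sm := slice_repP om; have um := slice_unit sm.
have Xm : X w (flag (slice_rep v (cell_point w m))).
  by apply: (slice_rep_schubert w om).1; apply: cell_schubert; apply: cell_point_cell.
have [/(F1p _ um)|/(F2p _ um)] := N12 _ (slice_kl sm Xm).
  by move/eqP: p1m.
by move/eqP: p2m.
Qed.

Lemma kl_sub v x y : bruhat_le x y -> N v x `<=` N v y.
Proof. by move=> xy z [Xz Oz]; split=> //; apply: schubert_le xy _ Xz. Qed.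

(** Through the retraction, equality would give an inclusion of [X y] in [X x] on the big cell, and
    everywhere by density. Then [y] would be in [X x], against the lengths. *)
Lemma kl_proper v x y : bruhat_le v x -> bruhat_step x y -> N v x `<` N v y.
Proof.
move=> vx xy; split; first by apply: kl_sub; apply: bruhat_step_le.
move=> Nyx; have vy := bruhat_le_trans vx (bruhat_step_le xy).
have Xv : X y (flag (pmat C v)) by apply: (schubert_le vy); apply: schubert_pmat.
have sv : slice v (pmat C v) by exists 1%:M; [apply: unip1 | rewrite mul1mx].
(* Were the Schubert cell disjoint from the big cell, the closed set attached to the constant [1]
   would contain [X y] and so [v], whence [1 = 0]. *)
have [m0 G0] : exists m, cell_eqn v (cell_point (C := C) y m) != 0.
  apply: contrapT => no; have := @oner_neq0 C; move/eqP; apply.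
  apply/(slice_zeroE (fun=> 1) sv).
  apply: (schubert_min (slice_zero_closed v (PolConst _ 1))) Xv => _ /cell_param[m _ ->].
  apply/cell_zeroE => //; first exact: cell_point_unit.
  by move=> /big_cellP om; case: no; exists m.
have Xyx : X y `<=` X x.
  refine (@schubert_dense C n y (X x) (@cell_eqn C n v) m0 (@schubert_closed C n x) (pol_cell_eqn C v) G0 _).
  move=> m /big_cellP om'.
  apply: (slice_rep_schubert x om').2; apply: (Nyx _ _).1; apply: slice_kl.
    exact: slice_repP.
  by apply: (slice_rep_schubert y om').1; apply: cell_schubert; apply: cell_point_cell.
have := schubert_pmat_inv (Xyx _ (@schubert_pmat C n y)).
by rewrite leqNgt (bruhat_step_lt xy).
Qed.

Lemma saturated_chain v w : bruhat_le v w -> exists x : nat -> 'S_n,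
  [/\ x (ninv w - ninv v)%N = w, forall i, bruhat_le v (x i),
    forall i, (i <= ninv w - ninv v)%N -> bruhat_le (x i) w &
    forall i, (i < ninv w - ninv v)%N -> bruhat_step (x i) (x i.+1)].
Proof.
move: {2}(ninv w) (erefl (ninv w)) => m; elim: m w => [|m IHm] w wm vw.
  have vE : v = w by case: (bruhat_le_inv vw) => //; rewrite wm.
  by exists (fun=> w); rewrite vE subnn; split=> // *; apply: bruhat_le_refl.
have [vE|/eqP nvw] := eqVneq v w.
  by exists (fun=> w); rewrite vE subnn; split=> // *; apply: bruhat_le_refl.
have [y [vy yw len]] := bruhat_le_chain vw nvw.
have ym : ninv y = m by move: len; rewrite wm => -[].
have [x [xy vx xle xstep]] := IHm y ym vy.
have le_vy := bruhat_le_ninv vy.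
have dE : (ninv w - ninv v = (ninv y - ninv v).+1)%N by rewrite len subSn.
(* Beyond its end the chain stays at [w], which is above [v] as required for every [i]. *)
exists (fun i => if (i <= ninv y - ninv v)%N then x i else w); rewrite dE; split.
- by rewrite ltnn.
- by move=> i; case: ifP.
- move=> i _; case: ifP => [/xle le_y|_]; last exact: bruhat_le_refl.
  exact: bruhat_le_trans le_y (bruhat_step_le yw).
move=> i; rewrite ltnS => le_i; rewrite le_i.
by case: ltngtP le_i => // [/xstep//|-> _]; rewrite xy.
Qed.

Lemma kl_chain v w : bruhat_le v w ->
  has_chain (@zariski_closed C n) (N v w) (ninv w - ninv v)%N.
Proof.
move=> vw; have [x [xw vx xle xstep]] := saturated_chain vw.
exists (fun i => N v (x i)); split=> [i le_i|i lt_i].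
  split; last exact: kl_irreducible.
  exists (X (x i)); first exact: schubert_closed.
  apply/seteqP; split=> [z Nz|z [[_ Oz] Xz]]; last by split.
  by split; [apply: kl_sub Nz; apply: xle | case: Nz].
by apply: kl_proper; [apply: vx | apply: xstep].
Qed.

Lemma kl_krull_dim (R : realType) v w : bruhat_le v w ->
  krull_dim (@zariski_closed C n) R (N v w) = ((ninv w - ninv v)%N%:R%:E)%E.
Proof.
move=> vw; apply/eqP; rewrite eq_le; apply/andP; split.
  apply: ub_ereal_sup => _ [d /chain_bound le_d <-].
  rewrite lee_fin ler_nat.
  by rewrite -(leq_add2r (ninv v)) subnK // bruhat_le_ninv.
apply: ereal_sup_ubound; exists (ninv w - ninv v)%N => //.
exact: kl_chain.
Qed.

End KazhdanLusztig.

(** * The complexity *)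

Lemma complexityE (R : realType) (n : nat) (v w : 'S_n) : bruhat_le v w ->
  complexity R v w = ((ninv w - ninv v)%N%:R
    - (cone_dim (@weight_cone R n v w))%:R)%R%:E%E.
Proof.
by move=> vw; rewrite /complexity kl_krull_dim.
Qed.

Theorem proposition3p20 (R : realType) (n : nat) (v w' w : 'S_n) :
  bruhat_le v w' -> bruhat_cover w' w ->
  complexity R v w = complexity R v w' \/
  complexity R v w = (complexity R v w' + 1)%E.
Proof.
move=> vw' cov; have [w'w len] := bruhat_coverP cov.
have vw : bruhat_le v w by apply: bruhat_le_trans vw' (bruhat_step_le w'w).
have le_v := bruhat_le_ninv vw'.
rewrite !complexityE // len subSn // -EFinD.
have /andP[lo hi] := cone_dim_cover R vw' cov.
(* The variety has gained one dimension, so the complexity rises by one exactly when the cone has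
   not grown. *)
have [eq_dim|neq_dim] := eqVneq (cone_dim (@weight_cone R n v w)) (cone_dim (@weight_cone R n v w')).
  by right; rewrite eq_dim -natr1 addrAC.
left; rewrite (_ : cone_dim (@weight_cone R n v w) = (cone_dim (@weight_cone R n v w')).+1).
  by rewrite -!natr1 opprD addrACA subrr addr0.
by apply/eqP; rewrite eqn_leq hi ltn_neqAle eq_sym neq_dim lo.
Qed.
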